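(* Let $\mathcal H^{(1)}=\mathcal H^{(1)}_R(a,b)$ be a generic pro-$p$ Hecke algebra for a pro-$p$ Coxeter group $W^{(1)}$ whose parameters $a_s$ are units and squares in $R$, with a choice of square roots and associated normalized Bernstein map $\widetilde\theta$ and elements $\Xi_{\mathfrak o}(H)$ (notation as in the context). Let $w\in W^{(1)}$ and let $\mathfrak o,\mathfrak o'$ be adjacent orientations of $W^{(1)}$. Then \[ \widetilde\theta_{\mathfrak o}(w)-\widetilde\theta_{\mathfrak o'}(w)=\Big(\sum_H\mathfrak o(1,H)\,\Xi_{\mathfrak o'}(H)\Big)\widetilde\theta_{\mathfrak o}(w), \] where the sum is taken over all hyperplanes $H\in\mathfrak H$ which separate $1$ and $\pi(w)$ and at which $\mathfrak o$ and $\mathfrak o'$ disagree.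
   Context: Coxeter group $(W_{\mathrm{aff}},S)$, length $\ell$, $m(s,t)$ the order of $st$, hyperplanes $\mathfrak H=\{vsv^{-1}:v\in W_{\mathrm{aff}},s\in S\}$; for $v=s_1\cdots s_r$ reduced the hyperplanes separating $1,v$ are $(s_1\cdots s_{i-1})s_i(s_1\cdots s_{i-1})^{-1}$; $H$ separates $v_1,v_2$ iff $v_1^{-1}Hv_1$ separates $1,v_1^{-1}v_2$. Extended Coxeter group $W=W_{\mathrm{aff}}\rtimes\Omega$ ($\Omega$ preserving $S$), $\ell(vu)=\ell(v)$, $vu$ identified with chamber $v$. Pro-$p$ Coxeter group: $1\to T\to W^{(1)}\xrightarrow{\pi}W\to1$, $T$ abelian, lifts $n_s\in\pi^{-1}(s)$ with braid relations, length $\ell\circ\pi$, $\Omega^{(1)}=\pi^{-1}(\Omega)$; $W^{(1)}$ acts on $T$, $R[T]$ by conjugation $w(\cdot)$. Generic pro-$p$ Hecke algebra $\mathcal H^{(1)}_R(a,b)$: $a_s\in R$, $b_s\in R[T]$ with $a_s=a_t$ and $(n_swn_t^{-1}w^{-1})w(b_t)=b_s$ whenever $s\pi(w)=\pi(w)t$; free on $\{T_w\}$, $T_{ww'}=T_wT_{w'}$ if lengths add, $T_{n_s}^2=a_sT_{n_s^2}+T_{n_s}b_s$, $R[T]$ embedded by $t\mapsto T_t$. $a_s$ depends only on the $W$-conjugacy class of $s$; $a_H:=a_s$ for $H$ conjugate to $s$; choose a square root $\sqrt{a_H}\in R^\times$ depending only on the class. Orientations of $W^{(1)}$: maps $(w,s)\mapsto\mathfrak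 o_0(v,usu^{-1})$ with $\pi(w)=vu$, $\mathfrak o_0:W_{\mathrm{aff}}\times S\to\{\pm1\}$ satisfying (OR1) $\mathfrak o_0(vs,s)=-\mathfrak o_0(v,s)$ and (OR2) (for $m(s,t)<\infty$, the sign sequences along $v,vs,vst,\dots$ and $v,vt,vts,\dots$ are ($k$ pluses, $m-k$ minuses) and ($m-k$ minuses, $k$ pluses), or both reversed). Right action $(\mathfrak o\bullet w)(w',s)=\mathfrak o(ww',s)$; $T$ acts trivially, so $\mathfrak o\bullet x$ makes sense for $x\in W$ via any lift. For $H\in\mathfrak H$, $\mathfrak o(1,H):=\mathfrak o(v_0,s)$ for any $v_0\in W_{\mathrm{aff}}$ (or a lift), $s\in S$ with $v_0sv_0^{-1}=H$ and $H$ not separating $1$ and $v_0$ (independent of choices). $\mathfrak o,\mathfrak o'$ disagree at $H$ if $\mathfrak o(1,H)\ne\mathfrak o'(1,H)$; they are adjacent if for every $H$ at which they disagree, $\mathfrak o\bullet s_H=\mathfrak o'$, where $s_H=H\in W_{\mathrm{aff}}$. Integral Bernstein map: $\widehat\theta_{\mathfrak o}(w)=T_1\cdots T_rT_u$ for $w=n_{s_1}\cdots n_{s_r}u$, $u\in\Omega^{(1)}$, $r=\ell(w)$, with $T_i=T_{n_{s_i}}$ if $\mathfrak o(n_{s_1}\cdots n_{s_{i-1}},s_i)=+1$ and $T_{n_{s_i}}-b_{s_i}$ otherwise (independent of expression). Normalized: $\widetilde\theta_{\mathfrak o}(w)=\overline{\sqrt{\mathbb L}}(w)^{-1}\widehat\theta_{\mathfrak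 o}(w)$, where $\overline{\sqrt{\mathbb L}}(w)=\prod_H\sqrt{a_H}$ over $H$ separating $1$ and $\pi(w)$. For $H\in\mathfrak H$, $\Xi_{\mathfrak o}(H):=\sqrt{a_s}^{-1}\,w(b_s)\,\widetilde\theta_{\mathfrak o}(wn_s^{-1}w^{-1})$ for any $w\in W^{(1)}$, $s\in S$ with $\pi(wn_sw^{-1})=H$ (this element is independent of the choice of $w,s$). *)

(* Defs.v *)
From HB Require Import structures.
From mathcomp Require Import all_boot all_algebra.
From Stdlib Require Import ClassicalEpsilon Relation_Operators.

Set Implicit Arguments.
Unset Strict Implicit.
Unset Printing Implicit Defensive.

Import GRing.Theory.
Local Open Scope ring_scope.

Definition wprod (G : groupType) (l : seq G) : G := foldr (fun x y => x * y)%g 1%g l.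

Definition order_is (G : groupType) (x : G) (n : nat) : Prop :=
  (0 < n)%N /\ (x ^+ n)%g = 1%g /\ forall k, (0 < k < n)%N -> (x ^+ k)%g <> 1%g.

Definition alt (G : groupType) (s t : G) (n : nat) : seq G :=
  mkseq (fun i => if odd i then t else s) n.

Section Coxeter.
Variables (W : groupType) (S : pred W).

(* one elementary move of the Coxeter presentation
   < S | s^2 = 1, (st)^{m(s,t)} = 1 > on words, m(s,t) = order of st *)
Inductive cox_step : seq W -> seq W -> Prop :=
| cox_del u v s : S s -> cox_step (u ++ [:: s; s] ++ v) (u ++ v)
| cox_braid u v s t m : S s -> S t -> order_is (s * t)%g m ->
    cox_step (u ++ alt s t m ++ v) (u ++ alt t s m ++ v).

Definition coxeter_system (Wa : pred W) : Prop :=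
  {subset S <= Wa} /\
  (forall s, S s -> order_is s 2) /\
  (forall v, Wa v -> exists l, all S l /\ wprod l = v) /\
  (forall l1 l2, all S l1 -> all S l2 -> wprod l1 = wprod l2 ->
     clos_refl_sym_trans _ cox_step l1 l2).

Definition reduced (l : seq W) : Prop :=
  all S l /\ forall l', all S l' -> wprod l' = wprod l -> (size l <= size l')%N.

Definition redword (v : W) : seq W :=
  epsilon (inhabits [::]) (fun l => reduced l /\ wprod l = v).

Variables (Wa Om : pred W).

Definition ext_coxeter : Prop :=
  coxeter_system Wa /\
  (1 \in Wa)%g /\ (forall x y, Wa x -> Wa y -> Wa (x * y^-1)%g) /\
  (1 \in Om)%g /\ (forall x y, Om x -> Om y -> Om (x * y^-1)%g) /\
  (forall v w, Wa v -> Wa (w * v * w^-1)%g) /\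
  (forall x, exists v u, Wa v /\ Om u /\ x = (v * u)%g) /\
  (forall u, Wa u -> Om u -> u = 1%g) /\
  (forall u s, Om u -> S s -> S (u * s * u^-1)%g).

Definition decomp (x : W) : W * W :=
  epsilon (inhabits (1%g, 1%g)) (fun p => Wa p.1 /\ Om p.2 /\ x = (p.1 * p.2)%g).
Definition wpart (x : W) : W := (decomp x).1.
Definition opart (x : W) : W := (decomp x).2.

Definition lenW (x : W) : nat := size (redword (wpart x)).

Definition hyperplane (H : W) : Prop :=
  exists v s, Wa v /\ S s /\ H = (v * s * v^-1)%g.

(* the hyperplanes separating 1 and (the chamber of) x, computed from a
   reduced expression s_1 ... s_r of the Wa-part of x *)
Definition seps (x : W) : seq W :=
  let l := redword (wpart x) in
  undup [seq (wprod (take i l) * nth 1%g l i * (wprod (take i l))^-1)%g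
        | i <- iota 0 (size l)].

(* orientations of (Wa, S): o0 v s = true means +1 *)
Definition is_orientation (o0 : W -> W -> bool) : Prop :=
  (forall v s, Wa v -> S s -> o0 (v * s)%g s = ~~ o0 v s) /\
  (forall v s t m, Wa v -> S s -> S t -> order_is (s * t)%g m ->
     let f1 i := o0 (v * wprod (alt s t i))%g (if odd i then t else s) in
     let f2 i := o0 (v * wprod (alt t s i))%g (if odd i then s else t) in
     exists k, (k <= m)%N /\
       ((forall i, (i < m)%N -> f1 i = (i < k)%N /\ f2 i = (m - k <= i)%N) \/
        (forall i, (i < m)%N -> f1 i = (m - k <= i)%N /\ f2 i = (i < k)%N))).

Definition oH (o0 : W -> W -> bool) (H : W) : bool :=
  let p := epsilon (inhabits (1%g, 1%g))
     (fun p => Wa p.1 /\ S p.2 /\ (p.1 * p.2 * p.1^-1)%g = H /\ H \notin seps p.1) in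
  o0 p.1 p.2.

End Coxeter.

Section ProP.
Variables (W : groupType) (S Wa Om : pred W) (W1 : groupType) (pi : W1 -> W)
  (n : W -> W1).

Definition proP_coxeter : Prop :=
  ext_coxeter S Wa Om /\
  (forall x y, pi (x * y)%g = (pi x * pi y)%g) /\
  (forall y, exists x, pi x = y) /\
  (forall t t', pi t = 1%g -> pi t' = 1%g -> (t * t')%g = (t' * t)%g) /\
  (forall s, S s -> pi (n s) = s) /\
  (forall s t m, S s -> S t -> order_is (s * t)%g m ->
     wprod (map n (alt s t m)) = wprod (map n (alt t s m))).

Definition oW1 (o0 : W -> W -> bool) (w : W1) (s : W) : bool :=
  let x := pi w in
  o0 (wpart Wa Om x) (opart Wa Om x * s * (opart Wa Om x)^-1)%g.

Definition adjacent (o0 o0' : W -> W -> bool) : Prop :=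
  forall H, hyperplane S Wa H -> oH S Wa Om o0 H != oH S Wa Om o0' H ->
    forall x, pi x = H -> forall w' s, S s -> oW1 o0 (x * w')%g s = oW1 o0' w' s.

Variables (R : comUnitRingType) (A : algType R) (a : W -> R)
  (b : W -> seq (R * W1)) (T : W1 -> A) (sqa : W -> R).

(* image in A of an element of R[T] given as a formal sum *)
Definition Tb (f : seq (R * W1)) : A := \sum_(p <- f) p.1 *: T p.2.
Definition conjb (w : W1) (f : seq (R * W1)) : seq (R * W1) :=
  [seq (p.1, (w * p.2 * w^-1)%g) | p <- f].

Definition len1 (w : W1) : nat := lenW S Wa Om (pi w).

Definition generic_hecke : Prop :=
  (forall s, S s -> all (fun p => pi p.2 == 1%g) (b s)) /\
  (forall s t w, S s -> S t -> (s * pi w)%g = (pi w * t)%g ->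
      a s = a t /\
      T (n s * w * (n t)^-1 * w^-1)%g * Tb (conjb w (b t)) = Tb (b s)) /\
  (forall x : A, exists f, x = Tb f) /\
  (forall (l : seq W1) (c : W1 -> R), uniq l ->
      \sum_(w <- l) c w *: T w = 0 -> forall w, w \in l -> c w = 0) /\
  (forall w w', len1 (w * w')%g = (len1 w + len1 w')%N -> T (w * w')%g = T w * T w') /\
  (forall s, S s -> T (n s) ^+ 2 = a s *: T (n s * n s)%g + T (n s) * Tb (b s)).

Definition sqrt_params : Prop :=
  (forall s, S s -> a s \is a GRing.unit) /\
  (forall s, S s -> sqa s \is a GRing.unit) /\
  (forall s, S s -> sqa s ^+ 2 = a s) /\
  (forall s t x, S s -> S t -> t = (x * s * x^-1)%g -> sqa s = sqa t).

Definition sqaH (H : W) : R :=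
  sqa (epsilon (inhabits 1%g) (fun s => S s /\ exists x, H = (x * s * x^-1)%g)).

Definition Lbar (w : W1) : R := \prod_(H <- seps S Wa Om (pi w)) sqaH H.

Definition bdec (w : W1) : seq W * W1 :=
  epsilon (inhabits ([::], 1%g)) (fun p =>
    all S p.1 /\ size p.1 = len1 w /\ Om (pi p.2) /\ w = (wprod (map n p.1) * p.2)%g).

Definition theta_hat (o0 : W -> W -> bool) (w : W1) : A :=
  let l := (bdec w).1 in let u := (bdec w).2 in
  (\prod_(i <- iota 0 (size l))
     (let si := nth 1%g l i in
      if oW1 o0 (wprod (map n (take i l))) si then T (n si)
      else T (n si) - Tb (b si))) * T u.

Definition theta_tilde (o0 : W -> W -> bool) (w : W1) : A :=
  (Lbar w)^-1 *: theta_hat o0 w.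

Definition Xi (o0 : W -> W -> bool) (H : W) : A :=
  let p := epsilon (inhabits (1%g, 1%g))
     (fun p : W1 * W => S p.2 /\ pi (p.1 * n p.2 * p.1^-1)%g = H) in
  (sqa p.2)^-1 *: (Tb (conjb p.1 (b p.2)) *
                   theta_tilde o0 (p.1 * (n p.2)^-1 * p.1^-1)%g).

Definition sgnR (e : bool) : R := if e then 1 else -1.

End ProP.

(* Main.v *)
(* The normalized Bernstein map satisfies the cocycle rule
   theta_o(w w') = theta_o(w) theta_(o . w)(w'), since it can be computed along any
   gallery, reduced or not: the product of the theta_o(n_s) along a gallery is, up
   to T, unchanged by the moves of the Coxeter presentation (OR1 handles s^2 = 1,
   OR2 the braid moves).  The formula then follows by appending one simple
   reflection s to a reduced word of w1: a new term appears iff o and o' disagree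
   at the wall H crossed last, and then adjacency, o . s_H = o', gives
     Xi_o'(H) theta_o(w1 n_s) = Xi_o'(H) theta_(o' . s_H)(w1 n_s)
       = sqrt(a_s)^-1 w1(b_s) theta_o'(w1) = theta_o'(w1) sqrt(a_s)^-1 b_s,
   with theta_o(n_s) - theta_o'(n_s) = o(1,H) sqrt(a_s)^-1 b_s in the translated
   orientations. *)

Require Import Defs.
From HB Require Import structures.
From mathcomp Require Import all_boot all_algebra.
From Stdlib Require Import ClassicalEpsilon Relation_Operators.

Set Implicit Arguments.
Unset Strict Implicit.
Unset Printing Implicit Defensive.

Import GRing.Theory.
Local Open Scope ring_scope.

(** * Galleries and the hyperplanes they cross *)

Section Words.
Local Open Scope group_scope.
Variable W : groupType.
Implicit Types (x y s t H : W) (l : seq W).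

Definition cj x y : W := x * y * x^-1.

Lemma cjM x y z : cj (x * y) z = cj x (cj y z).
Proof. by rewrite /cj invgM !mulgA. Qed.

Lemma cj1 x : cj 1 x = x.
Proof. by rewrite /cj mul1g invg1 mulg1. Qed.

Lemma cjg1 x : cj x 1 = 1.
Proof. by rewrite /cj mulg1 mulgV. Qed.

Lemma cjK x : cancel (cj x) (cj x^-1).
Proof. by move=> y; rewrite -cjM mulVg cj1. Qed.

Lemma cjVK x : cancel (cj x^-1) (cj x).
Proof. by move=> y; rewrite -cjM mulgV cj1. Qed.

Lemma cj_eq x y z : (cj x y == z) = (y == cj x^-1 z).
Proof. by rewrite (can2_eq (cjK x) (cjVK x)). Qed.

Lemma mul_cj x y : cj x y * x = x * y.
Proof. by rewrite /cj mulgVK. Qed.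

Lemma wprod_cat l1 l2 : wprod (l1 ++ l2) = wprod l1 * wprod l2.
Proof. by elim: l1 => [|s l IH] /=; rewrite ?mul1g // IH mulgA. Qed.

Lemma wprod_rcons l s : wprod (rcons l s) = wprod l * s.
Proof. by rewrite -cats1 wprod_cat /= mulg1. Qed.

Lemma wprod_cj x l : wprod (map (cj x) l) = cj x (wprod l).
Proof.
elim: l => [|s l IH] /=; first by rewrite /cj mulg1 mulgV.
by rewrite IH /cj !mulgA mulgVK.
Qed.

Lemma altS s t m : alt s t m.+1 = s :: alt t s m.
Proof.
rewrite /alt /mkseq /= (iotaDl 1 0) -map_comp; congr cons.
by apply: eq_map => i /=; case: (odd i).
Qed.

Lemma size_alt s t m : size (alt s t m) = m.
Proof. exact: size_mkseq. Qed.

Lemma nth_alt s t m i : (i < m)%N -> nth 1 (alt s t m) i = if odd i then t else s.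
Proof. exact: nth_mkseq. Qed.

Lemma take_alt s t m i : (i <= m)%N -> take i (alt s t m) = alt s t i.
Proof. by move=> im; rewrite /alt -[in LHS](subnKC im) /mkseq iotaD map_cat take_size_cat // size_map size_iota. Qed.

Lemma all_alt (P : pred W) s t m : P s -> P t -> all P (alt s t m).
Proof. by move=> Ps Pt; apply/(all_nthP 1) => i; rewrite size_alt => im; rewrite nth_alt //; case: odd. Qed.

(* The hyperplanes crossed by the gallery of type [l] starting at [x]. *)
Fixpoint walls x l : seq W :=
  if l is s :: l' then cj x s :: walls (x * s) l' else [::].

Lemma size_walls x l : size (walls x l) = size l.
Proof. by elim: l x => //= s l IH x; rewrite IH. Qed.

Lemma walls_cat x l1 l2 : walls x (l1 ++ l2) = walls x l1 ++ walls (x * wprod l1) l2.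
Proof. by elim: l1 x => [|s l IH] x /=; rewrite ?mulg1 // IH mulgA. Qed.

Lemma walls_rcons x l s : walls x (rcons l s) = rcons (walls x l) (cj (x * wprod l) s).
Proof. by rewrite -!cats1 walls_cat. Qed.

Lemma wallsM x y l : walls (x * y) l = map (cj x) (walls y l).
Proof. by elim: l y => //= s l IH y; rewrite -mulgA IH cjM. Qed.

Lemma walls_cj x y l : walls x (map (cj y) l) = map (cj (x * y)) (walls 1 l).
Proof.
rewrite -wallsM mulg1; elim: l x => //= s l IH x.
by rewrite IH cjM -[x * cj y s * y]mulgA mul_cj mulgA.
Qed.

Lemma nth_walls x l i : (i < size l)%N ->
  nth 1 (walls x l) i = cj (x * wprod (take i l)) (nth 1 l i).
Proof.
elim: l x i => //= s l IH x [|i] /=; first by rewrite mulg1.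
by rewrite ltnS => /IH ->; rewrite mulgA.
Qed.

Lemma walls_iota l :
  walls 1 l = [seq wprod (take i l) * nth 1 l i * (wprod (take i l))^-1 | i <- iota 0 (size l)].
Proof.
apply: (@eq_from_nth _ 1); first by rewrite size_walls size_map size_iota.
by move=> i; rewrite size_walls => il; rewrite nth_walls // (nth_map 0%N) ?size_iota // nth_iota // mul1g.
Qed.

Lemma mem_wallsP x l H : H \in walls x l ->
  exists l1 t l2, l = l1 ++ t :: l2 /\ H = cj (x * wprod l1) t.
Proof.
elim: l x => //= s l IH x; rewrite inE => /orP[/eqP->|/IH[l1 [t [l2 [-> ->]]]]].
  by exists [::], s, l; rewrite /= mulg1.
by exists (s :: l1), t, l2; rewrite /= mulgA.
Qed.

Lemma count_map_cj x H l : count_mem H (map (cj x) l) = count_mem (cj x^-1 H) l.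
Proof. by rewrite count_map; apply: eq_count => y /=; rewrite cj_eq. Qed.

Lemma mem_map_cj x H l : (H \in map (cj x) l) = (cj x^-1 H \in l).
Proof. by rewrite -{1}(cjVK x H) mem_map //; apply: can_inj (cjK x). Qed.

End Words.

(** * Dihedral subgroups and the two alternating words of a braid move *)

Section Involutions.
Local Open Scope group_scope.
Variables (W : groupType) (s t : W).

Lemma invol_inv (r : W) : r * r = 1 -> r^-1 = r.
Proof. exact: mulg1_eq. Qed.

Lemma expg_swap i : s * (t * s) ^+ i = (s * t) ^+ i * s.
Proof.
elim: i => [|i IH]; first by rewrite !expg0 mulg1 mul1g.
by rewrite expgSr mulgA IH (expgSr (s * t)) !mulgA.
Qed.

End Involutions.

Section Dihedral.
Local Open Scope group_scope.
Variables (W : groupType).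

Lemma walls_alt (s t : W) x k : s * s = 1 -> t * t = 1 ->
  walls x (alt s t k) = mkseq (fun i => cj x ((s * t) ^+ i * s)) k.
Proof.
move=> + + ; elim: k s t x => // k IH s t x s2 t2.
rewrite altS /= IH // /mkseq /= (iotaDl 1 0) -map_comp expg0 mul1g; congr cons.
apply: eq_map => i /=; rewrite cjM; congr cj.
by rewrite /cj (invol_inv s2) mulgA expg_swap // expgSr !mulgA.
Qed.

(** The two halves of a [2m]-gon cross the same walls in opposite order, because [(st)^m = 1] gives
    [(ts)^i t = (st)^(m-i-1) s]. *)
Lemma rev_walls_alt (s t : W) x m : s * s = 1 -> t * t = 1 -> (s * t) ^+ m = 1 ->
  walls x (alt t s m) = rev (walls x (alt s t m)).
Proof.
move=> s2 t2 stm; rewrite !walls_alt //.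
apply: (@eq_from_nth _ 1); rewrite ?size_rev !size_mkseq // => i im.
rewrite nth_rev ?size_mkseq // !nth_mkseq ?ltn_subrL ?(leq_ltn_trans _ im) //.
congr cj; have -> : t * s = (s * t)^-1 by rewrite invgM !invol_inv.
have e : (s * t) ^+ (m - i.+1) * (s * t) * (s * t) ^+ i = 1.
  by rewrite -expgSr -expgnDr addSnnS subnK.
by rewrite expVgn -(mulg1_eq e) invgK -!mulgA t2 mulg1.
Qed.

Lemma wprod_alt (s t : W) m : s * s = 1 -> t * t = 1 -> (s * t) ^+ m = 1 ->
  wprod (alt s t m) = wprod (alt t s m).
Proof.
case: m => // m s2 t2 stm; have m1 : (m < m.+1)%N by [].
(* As [(st)^(m+1) = 1], the last wall [(st)^m s] equals [t]. Pulling the last letter through the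
   prefix therefore puts [t] in front, which is the other word. *)
have := nth_walls 1 (l := alt s t m.+1) (i := m); rewrite size_alt => /(_ m1).
rewrite walls_alt // nth_mkseq // cj1 mul1g take_alt // -[X in _ = cj _ X]mulg1 => e.
rewrite -[in LHS](cat_take_drop m (alt s t m.+1)) wprod_cat take_alt //.
rewrite [alt t s m.+1]altS.
have -> : drop m (alt s t m.+1) = [:: nth 1 (alt s t m.+1) m].
  by rewrite (drop_nth 1) ?size_alt // drop_oversize ?size_alt.
rewrite /= -mul_cj -e; congr (_ * _); apply: (can_inj (mulgK t)).
by rewrite t2 -mulgA -expgSr.
Qed.

Lemma uniq_walls_alt (s t : W) x m : s * s = 1 -> t * t = 1 -> order_is (s * t) m ->
  uniq (walls x (alt s t m)).
Proof.
move=> s2 t2 [_ [_ ord]]; rewrite walls_alt //.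
suff main i j : (i < j < m)%N -> (s * t) ^+ i <> (s * t) ^+ j.
  apply/(uniqP 1) => i j; rewrite !inE size_mkseq => im jm.
  rewrite !nth_mkseq // => /(can_inj (cjK x))/(can_inj (mulgK s)) e.
  by case: (ltngtP i j) => // ij; [case: (@main i j) | case: (@main j i)]; rewrite ?ij ?im ?jm.
case/andP=> ij jm; rewrite -(subnKC (ltnW ij)) expgnDr -{1}[_ ^+ i]mulg1 => /mulgI/esym.
by apply: ord; rewrite subn_gt0 ij (leq_ltn_trans (leq_subr _ _) jm).
Qed.

End Dihedral.

(** * Coxeter systems *)

Section Coxeter.
Local Open Scope group_scope.
Variables (W : groupType) (S Wa : pred W).
Hypothesis cox : coxeter_system S Wa.

Lemma gen_sq s : S s -> s * s = 1.
Proof. by case: cox => _ [+ _] => /[apply] -[_ []]. Qed.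

Lemma gen_inv s : S s -> s^-1 = s.
Proof. by move/gen_sq/mulg1_eq. Qed.

(** [cox_step] allows arbitrary contexts [u], [v]. Each move preserves [all S] in both directions,
    so a chain joining two words in [S] consists of such words and the moves need checking only
    there. *)
Lemma word_rel_ind (E : seq W -> seq W -> Prop) :
  (forall l, E l l) -> (forall l1 l2, E l1 l2 -> E l2 l1) ->
  (forall l1 l2 l3, E l1 l2 -> E l2 l3 -> E l1 l3) ->
  (forall u v s, all S u -> all S v -> S s -> E (u ++ [:: s; s] ++ v) (u ++ v)) ->
  (forall u v s t m, all S u -> all S v -> S s -> S t -> order_is (s * t) m ->
     E (u ++ alt s t m ++ v) (u ++ alt t s m ++ v)) ->
  forall l1 l2, all S l1 -> all S l2 -> wprod l1 = wprod l2 -> E l1 l2.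
Proof.
move=> Er Es Et Edel Ebraid l1 l2 Sl1 Sl2 e12.
case: cox => _ [_ [_ /(_ l1 l2 Sl1 Sl2 e12) step]].
suff: all S l1 = all S l2 /\ (all S l1 -> E l1 l2) by case=> _; apply.
elim: step => {l1 l2 Sl1 Sl2 e12} [_ _ [u v s Ss|u v s t m Ss St ord]|l|l1 l2 _ [e IH]|l1 l2 l3 _ [e1 IH1] _ [e2 IH2]].
- by rewrite !all_cat /= Ss; split=> // /andP[Su Sv]; apply: Edel.
- by rewrite !all_cat !all_alt //; split=> // /and3P[Su _ Sv]; apply: Ebraid.
- by [].
- by rewrite e; split=> // Sl; apply/Es/IH; rewrite e.
- by rewrite e1 e2; split=> // Sl; apply: Et (IH1 _) (IH2 _); rewrite ?e1 e2.
Qed.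

(* Weights in Z/2 give the parity of the number of crossings of [H]; the signs
   of an orientation show that it is constant along each side of [H]. *)
Fixpoint crossing (V : zmodType) (f : W -> W -> V) H x (l : seq W) : V :=
  if l is s :: l' then
    ((if cj x s == H then f x s else 0) + crossing f H (x * s)%g l')%R
  else 0%R.

Lemma crossing_cat (V : zmodType) (f : W -> W -> V) H x l1 l2 :
  crossing f H x (l1 ++ l2) = (crossing f H x l1 + crossing f H (x * wprod l1)%g l2)%R.
Proof. by elim: l1 x => [|s l IH] x /=; rewrite ?mulg1 ?add0r // IH mulgA addrA. Qed.

Lemma crossing_sum (V : zmodType) (f : W -> W -> V) H x l :
  crossing f H x l = (\sum_(0 <= i < size l | nth 1%g (walls x l) i == H)
    f (x * wprod (take i l))%g (nth 1%g l i))%R.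
Proof.
elim: l x => [|s l IH] x /=; first by rewrite big_geq.
rewrite big_mkcond big_nat_recl //= mulg1 IH [in RHS]big_mkcond /=.
by congr (_ + _)%R; rewrite -big_mkcond; apply: eq_bigr => i _; rewrite mulgA.
Qed.

Lemma crossing_notin (V : zmodType) (f : W -> W -> V) H x l :
  H \notin walls x l -> crossing f H x l = 0%R.
Proof.
elim: l x => //= s l IH x; rewrite inE negb_or => /andP[ne /IH->].
by rewrite eq_sym (negPf ne) addr0.
Qed.

(** A move [ss] crosses one wall twice, and the first hypothesis cancels the weights. A braid move
    reverses the order of the walls: position [i] in one word meets the same wall as position
    [m-i-1] in the other, where the second hypothesis equates the weights. *)
Lemma crossing_inv (V : zmodType) (f : W -> W -> V) H x :
  (forall l, all S l -> forall s, S s -> (f (x * wprod l)%g s + f (x * wprod l * s)%g s = 0)%R) ->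
  (forall l s t m, all S l -> S s -> S t -> order_is (s * t) m -> forall i, (i < m)%N ->
     f (x * wprod l * wprod (alt t s i)) (if odd i then s else t) =
     f (x * wprod l * wprod (alt s t (m - i.+1))) (if odd (m - i.+1) then t else s)) ->
  forall l1 l2, all S l1 -> all S l2 -> wprod l1 = wprod l2 ->
  crossing f H x l1 = crossing f H x l2.
Proof.
move=> fs fb l1 l2 Sl1 Sl2 e12.
suff: wprod l1 = wprod l2 /\ crossing f H x l1 = crossing f H x l2 by case.
apply: (@word_rel_ind (fun l1 l2 => wprod l1 = wprod l2 /\ crossing f H x l1 = crossing f H x l2)) => //.
- by move=> {e12} l3 l4 [-> ->].
- by move=> {e12} l3 l4 l5 [-> ->].
- move=> u v s Su Sv Ss; have ss := gen_sq Ss; split.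
    by rewrite !wprod_cat /= mulg1 ss mul1g.
  rewrite !crossing_cat /= mulg1 ss mulg1 addr0; congr (_ + _)%R.
  have -> : cj (x * wprod u * s) s = cj (x * wprod u) s.
    by rewrite cjM; congr cj; rewrite /cj mulgK.
  by case: eqP => _; rewrite ?add0r // fs // add0r.
- move=> u v s t m Su Sv Ss St ord.
  have ss := gen_sq Ss; have tt := gen_sq St; have [m0 [stm _]] := ord.
  have rw := rev_walls_alt (x * wprod u) ss tt stm.
  have walt := wprod_alt ss tt stm.
  rewrite !wprod_cat walt; split=> //.
  rewrite !crossing_cat walt; congr (_ + (_ + _))%R.
  rewrite !crossing_sum !size_alt big_nat_rev big_nat_cond [RHS]big_nat_cond /=.
  apply: eq_big => i.
    case: ltnP => //= im.
    by rewrite add0n rw nth_rev ?size_walls ?size_alt.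
  case: ltnP => //= im _.
  have im' : (m - i.+1 < m)%N by rewrite ltn_subrL.
  rewrite add0n !nth_alt // !take_alt ?(ltnW im) ?(ltnW im') //.
  by symmetry; apply: fb ord _ im.
Qed.

(** Use the constant weight [true] in [bool], whose addition is exclusive or. *)
Lemma odd_walls H l1 l2 : all S l1 -> all S l2 -> wprod l1 = wprod l2 ->
  odd (count_mem H (walls 1 l1)) = odd (count_mem H (walls 1 l2)).
Proof.
have crossE x l : crossing (fun _ _ => true) H x l = odd (count_mem H (walls x l)).
  by elim: l x => //= s l IH x; rewrite oddD IH; case: eqP.
move=> Sl1 Sl2 e; rewrite -!crossE.
by apply: crossing_inv.
Qed.

Lemma deletion x l : all S l -> ~~ uniq (walls x l) ->
  exists l', all S l' /\ wprod l' = wprod l /\ (size l' < size l)%N.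
Proof.
elim: l x => //= s l IH x /andP[Ss Sl]; rewrite negb_and negbK => /orP[].
  case/mem_wallsP=> l1 [t [l2 [el eH]]]; exists (l1 ++ l2).
  move: Sl; rewrite el !all_cat /= => /and3P[-> St ->]; split=> //.
  rewrite !wprod_cat /= !size_cat /= addnS; split=> //.
  have e : s * wprod l1 * t = wprod l1.
    move: eH; rewrite -mulgA cjM => /(can_inj (cjK x)); rewrite cjM => eH.
    rewrite -mulgA -[wprod l1 * t]mul_cj.
    have -> : cj (wprod l1) t = s.
      by apply: (can_inj (cjK s)); rewrite -eH /cj mulgK.
    by rewrite mulgA gen_sq // mul1g.
  by rewrite !mulgA e.
by case/(IH _ Sl)=> l' [Sl' [e lt]]; exists (s :: l'); rewrite /= Ss e.
Qed.

(** A repeated wall permits a deletion. Conversely, a wall met exactly once by [l] is met an odd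
    number of times, hence at least once, by any word for the same element, so no such word is
    shorter. *)
Lemma reducedP l : all S l -> reduced S l <-> uniq (walls 1 l).
Proof.
move=> Sl; split=> [[_ red]|ul].
  apply: contraT => /(deletion Sl)[l' [Sl' [e]]].
  by rewrite ltnNge red.
split=> // l' Sl' e; rewrite -(size_walls 1 l) -(size_walls 1 l').
apply: uniq_leq_size => // H Hl.
have := odd_walls H Sl' Sl e; rewrite (count_uniq_mem H ul) Hl.
by rewrite -has_pred1 has_count; case: count.
Qed.

Lemma redwordP v : Wa v ->
  [/\ all S (redword S v), uniq (walls 1 (redword S v)) & wprod (redword S v) = v].
Proof.
move=> Wv; suff: exists l, reduced S l /\ wprod l = v.
  case/(epsilon_spec (inhabits [::])); rewrite -/(redword S v) => red ev.
  by have [Sl _] := red; split=> //; apply/reducedP.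
(* Descent on the length: as long as a wall repeats, [deletion] shortens the word. *)
case: cox => _ [_ [/(_ v Wv)[l [+ +]] _]].
have [k] := ubnP (size l); elim: k l => // k IH l /ltnSE lek Sl el.
case: (boolP (uniq (walls 1 l))) => [ul|/(deletion Sl)[l' [Sl' [e lt]]]].
  by exists l; split=> //; apply/reducedP.
by apply: (IH l') => //; [apply: leq_trans lt lek | rewrite e].
Qed.

Lemma wprod_mem l : (1 \in Wa)%g -> (forall x y, Wa x -> Wa y -> Wa (x * y^-1)) ->
  all S l -> Wa (wprod l).
Proof.
case: cox => SW _ W1 WV; elim: l => //= s l IH /andP[Ss Sl].
have := WV _ _ W1 (IH Sl); rewrite mul1g => /(WV s _); rewrite invgK; apply.
exact: SW.
Qed.

End Coxeter.

(** * Extended Coxeter groups *)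

Section Extended.
Local Open Scope group_scope.
Variables (W : groupType) (S Wa Om : pred W).
Hypothesis ext : ext_coxeter S Wa Om.
Implicit Types x y H : W.

Local Notation wpart := (wpart Wa Om).
Local Notation opart := (opart Wa Om).
Local Notation seps := (seps S Wa Om).

Lemma ext_cox : coxeter_system S Wa. Proof. by case: ext. Qed.
Lemma gen_Wa s : S s -> Wa s. Proof. by case: ext_cox => + _; apply. Qed.
Lemma Wa1 : Wa 1. Proof. by case: ext => _ []. Qed.
Lemma WaV x : Wa x -> Wa x^-1.
Proof. by case: ext => _ [_ [h _]] Wx; rewrite -[x^-1]mul1g; apply: h Wa1 Wx. Qed.
Lemma WaM x y : Wa x -> Wa y -> Wa (x * y).
Proof. by case: ext => _ [_ [h _]] Wx /WaV Wy; rewrite -[y]invgK; apply: h. Qed.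
Lemma Om1 : Om 1. Proof. by case: ext => _ [_ [_ []]]. Qed.
Lemma OmV x : Om x -> Om x^-1.
Proof. by case: ext => _ [_ [_ [_ [h _]]]] Wx; rewrite -[x^-1]mul1g; apply: h Om1 Wx. Qed.
Lemma OmM x y : Om x -> Om y -> Om (x * y).
Proof. by case: ext => _ [_ [_ [_ [h _]]]] Wx /OmV Wy; rewrite -[y]invgK; apply: h. Qed.
Lemma Wa_cj x y : Wa y -> Wa (cj x y).
Proof. by case: ext => _ [_ [_ [_ [_ [h _]]]]]; apply: h. Qed.
Lemma gen_cj u s : Om u -> S s -> S (cj u s).
Proof. by case: ext => _ [_ [_ [_ [_ [_ [_ [_ h]]]]]]]; apply: h. Qed.
Lemma gen_cj_word u l : Om u -> all S l -> all S (map (cj u) l).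
Proof. by move=> Ou Sl; rewrite all_map; apply: sub_all Sl => s; apply: gen_cj. Qed.

Lemma Wa_Om x : Wa x -> Om x -> x = 1.
Proof. by case: ext => _ [_ [_ [_ [_ [_ [_ [h _]]]]]]]; apply: h. Qed.

Lemma Wa_word l : all S l -> Wa (wprod l).
Proof. by apply: (wprod_mem ext_cox Wa1); case: ext => _ [_ []]. Qed.

Lemma decomp_inj v u v' u' : Wa v -> Om u -> Wa v' -> Om u' ->
  v * u = v' * u' -> v = v' /\ u = u'.
Proof.
move=> Wv Ou Wv' Ou' e.
have e1 : v'^-1 * v = u' * u^-1.
  by apply: (mulgI v'); rewrite mulVKg mulgA -e mulgK.
have e2 : v'^-1 * v = 1.
  by apply: Wa_Om; [apply: WaM (WaV _) _ | rewrite e1; apply: OmM (OmV _)].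
by split; [apply: (mulgI v'^-1); rewrite e2 mulVg | apply: (mulIg u^-1); rewrite -e1 e2 mulgV].
Qed.

Lemma decompP x : [/\ Wa (wpart x), Om (opart x) & x = wpart x * opart x].
Proof.
suff: exists p : W * W, Wa p.1 /\ Om p.2 /\ x = p.1 * p.2.
  by case/(epsilon_spec (inhabits (1, 1))) => ? [].
by case: ext => _ [_ [_ [_ [_ [_ [/(_ x)[v [u h]] _]]]]]]; exists (v, u).
Qed.

Lemma decompE v u : Wa v -> Om u -> wpart (v * u) = v /\ opart (v * u) = u.
Proof. by move=> Wv Ou; have [Wv' Ou' /esym/decomp_inj[]] := decompP (v * u). Qed.

Lemma wpart_id v : Wa v -> wpart v = v.
Proof. by move=> Wv; case: (decompE Wv Om1); rewrite mulg1. Qed.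

Lemma wpartM x y : wpart (x * y) = wpart x * cj (opart x) (wpart y) /\
  opart (x * y) = opart x * opart y.
Proof.
have [Wv Ou ex] := decompP x; have [Wv' Ou' ey] := decompP y.
have e : x * y = wpart x * cj (opart x) (wpart y) * (opart x * opart y).
  by rewrite {1}ex {1}ey /cj !mulgA mulgVK.
by rewrite e; apply: decompE; [apply: WaM (Wa_cj _ _) | apply: OmM].
Qed.

Definition word x := redword S (wpart x).

Lemma wordP x : [/\ all S (word x), uniq (walls 1 (word x)) & wprod (word x) = wpart x].
Proof. by have [Wx _ _] := decompP x; apply: redwordP ext_cox _ Wx. Qed.

Lemma expr_exists x : exists l u, [/\ all S l, Om u & x = wprod l * u].
Proof.
by have [Sl _ el] := wordP x; have [_ Ou ex] := decompP x; exists (word x), (opart x); rewrite el.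
Qed.

Lemma sepsE x : seps x = walls 1 (word x).
Proof. by have [_ ul _] := wordP x; rewrite walls_iota in ul *; rewrite /seps undup_id. Qed.

Lemma seps_uniq x : uniq (seps x).
Proof. exact: undup_uniq. Qed.

Lemma size_seps x : size (seps x) = lenW S Wa Om x.
Proof. by rewrite sepsE size_walls. Qed.

(** The parity of crossings depends only on the element, so the reduced word chosen in [seps] may be
    replaced by any word. *)
Lemma mem_seps l u H : all S l -> Om u ->
  (H \in seps (wprod l * u)) = odd (count_mem H (walls 1 l)).
Proof.
move=> Sl Ou; have [Sl' ul' el'] := wordP (wprod l * u).
have [ew _] := decompE (Wa_word Sl) Ou.
rewrite (odd_walls ext_cox H Sl Sl') ?el' ?ew // (count_uniq_mem _ ul') -sepsE.
by case: (H \in _).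
Qed.

Lemma seps_perm l u : all S l -> Om u -> uniq (walls 1 l) ->
  perm_eq (seps (wprod l * u)) (walls 1 l).
Proof.
move=> Sl Ou ul; apply: uniq_perm => // [|H]; first exact: seps_uniq.
by rewrite mem_seps // count_uniq_mem //; case: (_ \in _).
Qed.

(** Separation is additive modulo 2 along a path from [1] through [x] to [x * y]: concatenate words
    for [x] and [y], after conjugating the second by the [Om]-part of [x]. *)
Lemma mem_sepsM x y H : (H \in seps (x * y)) = (H \in seps x) (+) (cj x^-1 H \in seps y).
Proof.
have [l [u [Sl Ou ->]]] := expr_exists x; have [l' [u' [Sl' Ou' ->]]] := expr_exists y.
have Sl'' := gen_cj_word Ou Sl'.
have -> : wprod l * u * (wprod l' * u') = wprod (l ++ map (cj u) l') * (u * u').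
  by rewrite wprod_cat wprod_cj /cj !mulgA mulgVK.
rewrite !mem_seps ?all_cat ?Sl //; last exact: OmM.
by rewrite walls_cat walls_cj mul1g count_cat oddD count_map_cj.
Qed.

Lemma seps_Om u : Om u -> seps u = [::].
Proof.
move=> Ou; have := seps_perm (l := [::]) isT Ou isT.
by rewrite /= mul1g => /perm_size/size0nil.
Qed.

Lemma mem_seps_gen s H : S s -> (H \in seps s) = (H == s).
Proof.
move=> Ss; have := mem_seps (l := [:: s]) H _ Om1; rewrite /= Ss => /(_ isT).
by rewrite !mulg1 => ->; rewrite cj1 addn0 eq_sym; case: eqP.
Qed.

Lemma seps_hyperplane x H : H \in seps x -> hyperplane S Wa H.
Proof.
have [Sl _ _] := wordP x; rewrite sepsE => /mem_wallsP[l1 [s [l2 [el ->]]]].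
move: Sl; rewrite el all_cat /= => /and3P[Sl1 Ss _].
by exists (wprod l1), s; split; [apply: Wa_word | rewrite mul1g].
Qed.

(** The duplicate-free list on the left is contained in the list on the right; equal sizes then
    force equality and exclude repetitions. *)
Lemma seps_perm_add x y :
  lenW S Wa Om (x * y) = (lenW S Wa Om x + lenW S Wa Om y)%N ->
  perm_eq (seps (x * y)) (seps x ++ map (cj x) (seps y)).
Proof.
rewrite -!size_seps => e.
have sz : size (seps x ++ map (cj x) (seps y)) = size (seps (x * y)).
  by rewrite size_cat size_map e.
have sub : {subset seps (x * y) <= seps x ++ map (cj x) (seps y)}.
  by move=> H; rewrite mem_sepsM mem_cat mem_map_cj; case: (_ \in seps x); case: (_ \in seps y).
have le : (size (seps x ++ map (cj x) (seps y)) <= size (seps (x * y)))%N by rewrite sz.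
have [_ eqm] := uniq_min_size (seps_uniq _) sub le.
by apply: uniq_perm eqm; [apply: seps_uniq | apply: leq_size_uniq sub le; apply: seps_uniq].
Qed.

Lemma lenW_add x y : (forall H, H \in seps x -> cj x^-1 H \in seps y -> False) ->
  lenW S Wa Om (x * y) = (lenW S Wa Om x + lenW S Wa Om y)%N.
Proof.
move=> dis; rewrite -!size_seps -(size_map (cj x) (seps y)) -size_cat.
apply: perm_size; apply: uniq_perm; first exact: seps_uniq.
  rewrite cat_uniq seps_uniq map_inj_uniq ?seps_uniq ?andbT; last exact: can_inj (cjK x).
  by apply/hasPn => H /=; rewrite mem_map_cj => Hy; apply/negP => Hx; apply: dis Hx Hy.
move=> H; rewrite mem_sepsM mem_cat mem_map_cj.
by move: (dis H); case: (_ \in seps x); case: (_ \in seps y) => // /(_ isT isT).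
Qed.

Lemma mem_sepsV x H : (H \in seps x^-1) = (cj x H \in seps x).
Proof.
have := mem_sepsM x^-1 x H; rewrite mulVg seps_Om ?Om1 // invgK.
by case: (_ \in seps x^-1); case: (_ \in seps x).
Qed.

Lemma lenWV_add x y : (forall H, H \in seps x -> H \in seps y -> False) ->
  lenW S Wa Om (x^-1 * y) = (lenW S Wa Om x^-1 + lenW S Wa Om y)%N.
Proof.
by move=> dis; apply: lenW_add => H; rewrite mem_sepsV invgK; apply: dis.
Qed.

Lemma lenWV x : lenW S Wa Om x^-1 = lenW S Wa Om x.
Proof.
rewrite -!size_seps -(size_map (cj x) (seps x^-1)); apply: perm_size.
apply: uniq_perm; rewrite ?(map_inj_uniq (can_inj (cjK x))) ?seps_uniq // => H.
by rewrite mem_map_cj mem_sepsV cjVK.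
Qed.

(** * Orientations *)

(** (OR1) and (OR2) at every element of [W], with the rule for [Om] added. The conditions are
    invariant under left translation of the argument, so galleries may start at any base point. *)
Definition gallery_orientation (f : W -> W -> bool) : Prop :=
  [/\ forall x s, S s -> f (x * s) s = ~~ f x s,
      forall x u s, Om u -> f (x * u) s = f x (cj u s) &
      forall x s t m, S s -> S t -> order_is (s * t) m ->
        let f1 i := f (x * wprod (alt s t i)) (if odd i then t else s) in
        let f2 i := f (x * wprod (alt t s i)) (if odd i then s else t) in
        exists k, (k <= m)%N /\
          ((forall i, (i < m)%N -> f1 i = (i < k)%N /\ f2 i = (m - k <= i)%N) \/
           (forall i, (i < m)%N -> f1 i = (m - k <= i)%N /\ f2 i = (i < k)%N))].

Definition oW (o0 : W -> W -> bool) x s := o0 (wpart x) (cj (opart x) s).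

Lemma map_alt (h : W -> W) s t k : map h (alt s t k) = alt (h s) (h t) k.
Proof. by rewrite /alt /mkseq -map_comp; apply: eq_map => i /=; case: odd. Qed.

Lemma cj_mulg u x y : cj u (x * y) = cj u x * cj u y.
Proof. by rewrite /cj !mulgA mulgVK. Qed.

Lemma order_cj u x m : order_is x m -> order_is (cj u x) m.
Proof.
have cjX k : cj u x ^+ k = cj u (x ^+ k).
  elim: k => [|k IH]; first by rewrite !expg0 cjg1.
  by rewrite !expgS IH cj_mulg.
case=> [m0 [xm h]]; split=> //; rewrite cjX xm cjg1; split=> // k /h nx.
by rewrite cjX -(cjg1 u) => /(can_inj (cjK u)).
Qed.

Lemma oW_gallery o0 : is_orientation S Wa o0 -> gallery_orientation (oW o0).
Proof.
case=> o0s o0b; split=> [x s Ss|x u s Ou|x s t m Ss St ord].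
- have [Wx Ox _] := decompP x; have [ew eo] := wpartM x s.
  have [ews eos] := decompE (gen_Wa Ss) Om1; rewrite mulg1 in ews eos.
  by rewrite /oW ew eo ews eos mulg1 o0s //; apply: gen_cj.
- have [ew eo] := wpartM x u.
  have [ews eos] := decompE Wa1 Ou; rewrite mul1g in ews eos.
  by rewrite /oW ew eo ews eos cjg1 mulg1 cjM.
- have [Wx Ox _] := decompP x.
  have e r r' i : S r -> S r' -> oW o0 (x * wprod (alt r r' i)) =1
      fun q => o0 (wpart x * wprod (alt (cj (opart x) r) (cj (opart x) r') i)) (cj (opart x) q).
    move=> Sr Sr' q; have [ew eo] := wpartM x (wprod (alt r r' i)).
    have [|ews eos] := decompE (v := wprod (alt r r' i)) _ Om1.
      by apply: Wa_word; apply: all_alt.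
    by rewrite mulg1 in ews eos; rewrite /oW ew eo ews eos mulg1 -map_alt wprod_cj.
  have [|k [km h]] := o0b (wpart x) _ _ m Wx (gen_cj Ox Ss) (gen_cj Ox St).
    by rewrite -cj_mulg; apply: order_cj.
  exists k; split=> //.
  by (case: h => h; [left | right]) => i /h; rewrite !e //; case: odd.
Qed.

(** The sign at a wall depends only on the side from which it is crossed. Join [x] to [y] by a
    reduced word [ll]; it avoids the wall, as [x] and [y] lie on the same side. Crossing before [ll]
    or after it leads to the same chamber, so the signed crossing counts agree, and each count is a
    single sign. *)
Lemma orientation_wall f x y s t : gallery_orientation f -> S s -> S t ->
  cj x s = cj y t -> cj x s \notin seps x -> cj y t \notin seps y -> f x s = f y t.
Proof.
move=> fo Ss St eH nx ny; have [fs fO fb] := fo.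
have [l [u [Sl Ou eg]]] := expr_exists (x^-1 * y).
have [ll [Sll ull ell]] : exists l', [/\ all S l', uniq (walls 1 l') & wprod l' = wprod l].
  by have [? ? ?] := redwordP ext_cox (Wa_word Sl); exists (redword S (wprod l)).
have {}eg : y = x * wprod ll * u by rewrite ell -mulgA -eg mulVKg.
have ns : s \notin walls 1 ll.
  move: ny; rewrite -eH {1}eg -mulgA mem_sepsM (negPf nx) /= cjK mem_seps //.
  by rewrite count_uniq_mem //; case: (_ \in _).
have nw z : cj z s \notin walls z ll.
  by rewrite -[z in walls z]mulg1 wallsM mem_map_cj cjK.
have e : wprod (s :: ll) = wprod (rcons ll (cj u t)).
  move: eH; rewrite eg 2!cjM => /(can_inj (cjK x)) es.
  by rewrite wprod_rcons /= [X in X * _]es mul_cj.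
(* Signs are taken as integers so that crossing back and forth contributes zero. *)
pose g x s : int := (if f x s then 1 else -1)%R.
have : crossing g (cj x s) x (s :: ll) = crossing g (cj x s) x (rcons ll (cj u t)).
  apply: (crossing_inv ext_cox (f := g)) e.
  - by move=> l1 Sl1 r Sr; rewrite /g fs //; case: (f _ _).
  - move=> l1 r r' m Sl1 Sr Sr' ord i im; rewrite /g; congr (if _ then _ else _).
    (* (OR2) matches positions [i] and [m-i-1]: [m-k <= i] holds exactly when [m-i-1 < k]. *)
    have [k [km h]] := fb (x * wprod l1) _ _ _ Sr Sr' ord.
    have im' : (m - i.+1 < m)%N by rewrite ltn_subrL (leq_ltn_trans _ im).
    case: h => h; have [_ ->] := h _ im; have [-> _] := h _ im'.
      by rewrite subnSK // !leq_subLR addnC.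
    by rewrite leq_sub2lE.
  - by rewrite /= Ss.
  - by rewrite all_rcons Sll gen_cj.
have nws : cj x s \notin walls (x * s) ll.
  by have := nw (x * s); rewrite cjM {2}/cj mulgK.
rewrite -cats1 crossing_cat /= eqxx !crossing_notin // !addr0 add0r.
have -> : cj (x * wprod ll) (cj u t) == cj x s by rewrite eH eg -cjM.
by rewrite eg fO // /g; case: (f _ _); case: (f _ _).
Qed.

(** The choice made in [oH] is harmless by [orientation_wall], so the sign at a wall can be read off
    at any [x] on the side of [1]. *)
Lemma oHE o0 x s : is_orientation S Wa o0 -> S s -> cj x s \notin seps x ->
  oH S Wa Om o0 (cj x s) = oW o0 x s.
Proof.
move=> oo Ss nx; have [Wx Ox ex] := decompP x.
have : exists p : W * W, Wa p.1 /\ S p.2 /\ p.1 * p.2 * p.1^-1 = cj x s /\ cj x s \notin seps p.1.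
  exists (wpart x, cj (opart x) s); rewrite /= -/(cj (wpart x) _) -cjM -ex; do ?split=> //.
    exact: gen_cj.
  by rewrite /Defs.seps wpart_id.
case/(epsilon_spec (inhabits (1, 1))); rewrite /oH; set p := epsilon _ _ => Wp [Sp [ep np]].
have [ew eo] := decompE Wp Om1; rewrite mulg1 in ew eo.
rewrite -(orientation_wall (oW_gallery oo) Sp Ss ep) ?/cj ?ep //.
by rewrite /oW ew eo cj1.
Qed.

End Extended.

(** * Lengths of products of reduced words *)

Section ReducedWords.
Local Open Scope group_scope.
Variables (W : groupType) (S Wa Om : pred W).
Hypothesis ext : ext_coxeter S Wa Om.

Lemma walls_take (x : W) l k : walls x (take k l) = take k (walls x l).
Proof. by elim: l x k => [|s l IH] x [|k] //=; rewrite IH. Qed.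

Lemma uniq_walls (x y : W) l : uniq (walls x l) = uniq (walls y l).
Proof.
suff h z : uniq (walls z l) = uniq (walls 1 l) by rewrite !h.
by rewrite -[z in LHS]mulg1 wallsM map_inj_uniq //; apply: can_inj (cjK z).
Qed.

Lemma lenW_word l u : all S l -> Om u -> uniq (walls 1 l) ->
  lenW S Wa Om (wprod l * u) = size l.
Proof.
by move=> Sl Ou ul; rewrite -size_seps // (perm_size (seps_perm ext Sl Ou ul)) size_walls.
Qed.

Lemma lenW_wprod l : all S l -> uniq (walls 1 l) -> lenW S Wa Om (wprod l) = size l.
Proof. by move=> Sl ul; rewrite -(lenW_word Sl (Om1 ext) ul) mulg1. Qed.

Lemma lenW_uniq l u : all S l -> Om u -> lenW S Wa Om (wprod l * u) = size l ->
  uniq (walls 1 l).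
Proof.
move=> Sl Ou; rewrite -size_seps // sepsE // size_walls => e.
have [Sl' ul' el'] := wordP ext (wprod l * u).
have [_ min] := (reducedP (ext_cox ext) Sl').2 ul'.
apply/(reducedP (ext_cox ext) Sl); split=> // l2 Sl2 el2.
rewrite -e; apply: min => //; rewrite el2 el'.
by have [-> _] := decompE ext (Wa_word ext Sl) Ou.
Qed.

Lemma lenW_cat l1 l2 : all S (l1 ++ l2) -> uniq (walls 1 (l1 ++ l2)) ->
  [/\ uniq (walls 1 l1), uniq (walls 1 l2) &
   lenW S Wa Om (wprod l1 * wprod l2) = (lenW S Wa Om (wprod l1) + lenW S Wa Om (wprod l2))%N].
Proof.
move=> Sl ul; have /andP[Sl1 Sl2] : all S l1 && all S l2 by rewrite -all_cat.
have := ul; rewrite walls_cat cat_uniq => /and3P[ul1 _].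
rewrite (uniq_walls _ 1) => ul2; split=> //.
by rewrite -wprod_cat !lenW_wprod // size_cat.
Qed.

Lemma lenW_catV l1 l2 : all S (l1 ++ l2) -> uniq (walls 1 (l1 ++ l2)) ->
  lenW S Wa Om ((wprod l2)^-1 * (wprod l1)^-1) =
  (lenW S Wa Om (wprod l2)^-1 + lenW S Wa Om (wprod l1)^-1)%N.
Proof.
by move=> Sl ul; rewrite -invgM !lenWV //; have [_ _ ->] := lenW_cat Sl ul; rewrite addnC.
Qed.

End ReducedWords.

(** * Generic pro-p Hecke algebras *)

Section Hecke.
Variables (W : groupType) (S Wa Om : pred W) (W1 : groupType) (pi : W1 -> W) (n : W -> W1).
Variables (R : comUnitRingType) (A : algType R) (a : W -> R) (b : W -> seq (R * W1)).
Variables (T : W1 -> A) (sqa : W -> R).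
Hypothesis hW : proP_coxeter S Wa Om pi n.
Hypothesis hH : generic_hecke S Wa Om pi n a b T.
Hypothesis hsq : sqrt_params S a sqa.

Local Notation len := (lenW S Wa Om).
Local Notation seps := (seps S Wa Om).
Local Notation g l := (wprod (map n l)).

(** * Basis elements and commutation with [R[T]] *)

Lemma proP_ext : ext_coxeter S Wa Om. Proof. by case: hW. Qed.
Lemma piM x y : pi (x * y)%g = (pi x * pi y)%g. Proof. by case: hW => _ []. Qed.
Lemma pi_n s : S s -> pi (n s) = s.
Proof. by case: hW => _ [_ [_ [_ [h _]]]]; apply: h. Qed.
Lemma pi1 : pi 1%g = 1%g.
Proof. by apply: (mulgI (pi 1%g)); rewrite -piM !mulg1. Qed.
Lemma piV x : pi x^-1%g = (pi x)^-1%g.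
Proof. by apply/esym/mulg1_eq; rewrite -piM mulgV pi1. Qed.
Lemma pi_word l : all S l -> pi (g l) = wprod l.
Proof. by elim: l => [|s l IH] /=; rewrite ?pi1 // piM => /andP[/pi_n-> /IH->]. Qed.
Lemma g_cat l1 l2 : g (l1 ++ l2) = (g l1 * g l2)%g.
Proof. by rewrite map_cat wprod_cat. Qed.
Lemma n_braid s t m : S s -> S t -> order_is (s * t)%g m -> g (alt s t m) = g (alt t s m).
Proof. by case: hW => _ [_ [_ [_ [_ h]]]]; apply: h. Qed.

Lemma TM w w' : len (pi w * pi w')%g = (len (pi w) + len (pi w'))%N -> T (w * w')%g = T w * T w'.
Proof. by case: hH => _ [_ [_ [_ [h _]]]]; rewrite -piM; apply: h. Qed.

Lemma len_Oml u x : Om u -> len (u * x)%g = (len u + len x)%N.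
Proof. by move=> Ou; apply: (lenW_add proP_ext) => H; rewrite (seps_Om proP_ext Ou). Qed.

Lemma len_Omr u x : Om u -> len (x * u)%g = (len x + len u)%N.
Proof. by move=> Ou; apply: (lenW_add proP_ext) => H _; rewrite (seps_Om proP_ext Ou). Qed.

Lemma T_Oml u w : Om (pi u) -> T (u * w)%g = T u * T w.
Proof. by move=> Ou; apply/TM/len_Oml. Qed.

Lemma T_Omr u w : Om (pi u) -> T (w * u)%g = T w * T u.
Proof. by move=> Ou; apply/TM/len_Omr. Qed.

(** Since lengths add, [T 1] is a left unit for every basis element; the unit of [A] is a
    combination of these. *)
Lemma T1 : T 1%g = 1.
Proof.
have O1 : Om (pi 1%g) by rewrite pi1; apply: Om1 proP_ext.
have [_ [_ [/(_ 1)[f ef] _]]] := hH.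
rewrite -[LHS]mulr1 ef /Tb mulr_sumr; apply: eq_bigr => p _.
by rewrite -scalerAr -T_Oml // mul1g.
Qed.

Definition ker_sum (f : seq (R * W1)) := all (fun p => pi p.2 == 1%g) f.

Lemma ker_Om k : pi k = 1%g -> Om (pi k).
Proof. by move->; apply: Om1 proP_ext. Qed.

Lemma ker_cj w k : pi k = 1%g -> pi (w * k * w^-1)%g = 1%g.
Proof. by rewrite !piM piV => ->; rewrite mulg1 mulgV. Qed.

Lemma ker_sum_b s : S s -> ker_sum (b s).
Proof. by case: hH => + _; apply. Qed.

Lemma Tb_intertwine (X : A) w f : ker_sum f ->
  (forall k, pi k = 1%g -> X * T k = T (w * k * w^-1)%g * X) ->
  X * Tb T f = Tb T (conjb w f) * X.
Proof.
move=> /allP kf comm; rewrite /Tb big_map mulr_sumr mulr_suml; apply: eq_big_seq => p /kf/eqP kp.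
by rewrite -scalerAr comm // scalerAl.
Qed.

Lemma T_ker_comm w k : pi k = 1%g -> T w * T k = T (w * k * w^-1)%g * T w.
Proof.
move=> kk; rewrite -T_Omr ?ker_Om // -T_Oml ?ker_Om ?ker_cj //.
by rewrite mulgVK.
Qed.

Lemma T_Tb w f : ker_sum f -> T w * Tb T f = Tb T (conjb w f) * T w.
Proof. by move=> kf; apply: Tb_intertwine => // k; apply: T_ker_comm. Qed.

Lemma Tb_conj s t w : S s -> S t -> (s * pi w)%g = (pi w * t)%g ->
  T (n s * w * (n t)^-1 * w^-1)%g * Tb T (conjb w (b t)) = Tb T (b s).
Proof. by move=> Ss St e; have [_ [/(_ s t w Ss St e)[_]]] := hH. Qed.

Lemma conjbM (w w' : W1) (f : seq (R * W1)) : conjb (w * w')%g f = conjb w (conjb w' f).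
Proof. by rewrite /conjb -map_comp; apply: eq_map => p /=; rewrite invgM !mulgA. Qed.

(** Compatibility of the parameters for [w = n s] says that [b s] is fixed under conjugation by
    [n s]. *)
Lemma comm_nb s : S s -> T (n s) * Tb T (b s) = Tb T (b s) * T (n s).
Proof.
move=> Ss; rewrite T_Tb ?ker_sum_b //; congr (_ * _).
have := Tb_conj (w := n s) Ss Ss; rewrite pi_n // => /(_ erefl).
by rewrite mulgK mulgV T1 mul1r.
Qed.

Lemma conjb_ker k f : ker_sum f -> pi k = 1%g -> conjb k f = f.
Proof.
move=> /allP kf kk; rewrite /conjb -[RHS]map_id; apply/eq_in_map => -[c k'] /= fk.
have /eqP/= kk' := kf _ fk.
by case: hW => _ [_ [_ [/(_ k k' kk kk')-> _]]]; rewrite mulgK.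
Qed.

Lemma ker_sum_conjb w f : ker_sum f -> ker_sum (conjb w f).
Proof.
by rewrite /ker_sum all_map; apply: sub_all => p /eqP kp /=; rewrite ker_cj.
Qed.

Lemma comm_ker_sum k f : ker_sum f -> pi k = 1%g -> T k * Tb T f = Tb T f * T k.
Proof. by move=> kf kk; rewrite T_Tb // conjb_ker. Qed.

(** Compatibility for [w = k] in the kernel: after multiplication by [b s], conjugating [k] by [n s]
    is no longer visible. *)
Lemma Tb_coinv s k : S s -> pi k = 1%g ->
  T (n s * k * (n s)^-1)%g * Tb T (b s) = T k * Tb T (b s).
Proof.
move=> Ss kk; have kk' := ker_cj (n s) kk.
have := Tb_conj (w := k) Ss Ss; rewrite kk mulg1 mul1g conjb_ker ?ker_sum_b // => /(_ erefl) e.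
rewrite -[X in _ = _ * X]e mulrA -T_Oml ?ker_Om //; congr (T _ * _).
by case: hW => _ [_ [_ [comm _]]]; rewrite mulgA (comm _ _ kk kk') mulgK.
Qed.

(** * Normalization by square roots *)

Lemma sqa_unit s : S s -> sqa s \is a GRing.unit.
Proof. by case: hsq => _ [+ _]; apply. Qed.

Lemma sqaH_cj x s : S s -> sqaH S sqa (cj x s) = sqa s.
Proof.
move=> Ss; have ex : exists t, S t /\ exists y, cj x s = (y * t * y^-1)%g.
  by exists s; split=> //; exists x.
have := epsilon_spec (inhabits 1%g) _ ex; rewrite /sqaH; set t := epsilon _ _.
case=> St [y e]; case: hsq => _ [_ [_ h]].
by apply/esym/(h s t (y^-1 * x)%g) => //; rewrite -/(cj _ _) cjM e -/(cj y t) cjK.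
Qed.

Definition Lw x := \prod_(H <- seps x) sqaH S sqa H.

Lemma sqaH_hyp_cj x H : hyperplane S Wa H -> sqaH S sqa (cj x H) = sqaH S sqa H.
Proof. by case=> y [s [_ [Ss ->]]]; rewrite -/(cj y s) -cjM !sqaH_cj. Qed.

Lemma Lw_unit x : Lw x \is a GRing.unit.
Proof.
rewrite /Lw big_seq; apply: (big_ind (fun z => z \is a GRing.unit)) => [||H].
- exact: unitr1.
- by move=> y z uy uz; rewrite unitrM uy uz.
- by case/(seps_hyperplane proP_ext) => y [s [_ [Ss ->]]]; rewrite sqaH_cj // sqa_unit.
Qed.

Lemma LwM x y : len (x * y)%g = (len x + len y)%N -> Lw (x * y)%g = Lw x * Lw y.
Proof.
move/(seps_perm_add proP_ext) => p; rewrite /Lw (perm_big _ p) /= big_cat big_map /=; congr (_ * _).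
by apply: eq_big_seq => H /(seps_hyperplane proP_ext); apply: sqaH_hyp_cj.
Qed.

Lemma Lw_Om u : Om u -> Lw u = 1.
Proof. by move=> Ou; rewrite /Lw (seps_Om proP_ext Ou) big_nil. Qed.

Lemma Lw_word l : all S l -> uniq (walls 1 l) -> Lw (wprod l) = \prod_(s <- l) sqa s.
Proof.
move=> Sl ul; rewrite /Lw -[wprod l]mulg1 (perm_big _ (seps_perm proP_ext Sl (Om1 proP_ext) ul)) /=.
elim: l (1%g) Sl {ul} => [|s l IH] x /=; first by rewrite !big_nil.
by case/andP=> Ss Sl; rewrite !big_cons IH // sqaH_cj.
Qed.

Lemma Lw_gen s : S s -> Lw s = sqa s.
Proof. by move=> Ss; have := @Lw_word [:: s]; rewrite /= Ss mulg1 big_seq1 => ->. Qed.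

Definition tau w : A := (Lw (pi w))^-1 *: T w.

Lemma tauM w w' : len (pi w * pi w')%g = (len (pi w) + len (pi w'))%N ->
  tau (w * w')%g = tau w * tau w'.
Proof.
move=> e; rewrite /tau TM // piM LwM // invrM ?Lw_unit //.
by rewrite -scalerAr -scalerAl scalerA.
Qed.

Lemma tau_Om u : Om (pi u) -> tau u = T u.
Proof. by move=> Ou; rewrite /tau Lw_Om // invr1 scale1r. Qed.

(** * Normalized factors of single crossings and of reduced words *)

Definition theta (e : bool) s : A :=
  (sqa s)^-1 *: (if e then T (n s) else T (n s) - Tb T (b s)).

Lemma theta_true s : S s -> theta true s = tau (n s).
Proof. by move=> Ss; rewrite /tau pi_n // Lw_gen. Qed.

Lemma ker_n2 s : S s -> pi (n s * n s)%g = 1%g.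
Proof. by move=> Ss; rewrite piM pi_n // (gen_sq (ext_cox proP_ext)). Qed.

(** This is the quadratic relation, rewritten as [T (n s) * (T (n s) - b s) = a s *: T (n s * n s)]
    and divided by [a s = sqa s ^+ 2]. *)
Lemma theta_pm s : S s -> theta true s * theta false s = T (n s * n s)%g.
Proof.
move=> Ss; rewrite /theta -scalerAl -scalerAr scalerA mulrBr.
have [_ [_ [_ [_ [_ /(_ s Ss)]]]]] := hH; rewrite expr2 => ->.
rewrite addrK scalerA; have [_ [_ [/(_ s Ss)<- _]]] := hsq.
by rewrite expr2 mulrA mulrVK ?sqa_unit // mulVr ?sqa_unit // scale1r.
Qed.

Lemma theta_mp s : S s -> theta false s * theta true s = T (n s * n s)%g.
Proof.
move=> Ss; rewrite -theta_pm // /theta -!scalerAl -!scalerAr; congr (_ *: (_ *: _)).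
by rewrite mulrBl mulrBr comm_nb.
Qed.

Lemma theta_flip e s : S s -> theta e s * theta (~~ e) s = T (n s * n s)%g.
Proof. by case: e => Ss; [apply: theta_pm | apply: theta_mp]. Qed.

Lemma tau_nV s : S s ->
  tau (n s)^-1%g = theta true s * T (n s * n s)^-1%g /\
  tau (n s)^-1%g = T (n s * n s)^-1%g * theta true s.
Proof.
move=> Ss; have kk := ker_n2 Ss; have kk' : pi (n s * n s)^-1%g = 1%g by rewrite piV kk invg1.
rewrite /theta /tau piV pi_n // (gen_inv (ext_cox proP_ext)) // Lw_gen //.
split; [rewrite -scalerAl -T_Omr | rewrite -scalerAr -T_Oml]; rewrite ?ker_Om //.
  by rewrite invgM mulVKg.
by rewrite invgM mulgVK.
Qed.

(** A negative crossing is thus the inverse of a normalized basis element, which lets products of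
    negative crossings be handled by additivity of lengths. *)
Lemma theta_falseK s : S s ->
  theta false s * tau (n s)^-1%g = 1 /\ tau (n s)^-1%g * theta false s = 1.
Proof.
move=> Ss; have kk := ker_n2 Ss; have kk' : pi (n s * n s)^-1%g = 1%g by rewrite piV kk invg1.
have [e1 e2] := tau_nV Ss; rewrite {1}e1 {1}e2 -mulrA mulrA theta_mp // theta_pm //.
by rewrite -!T_Oml ?ker_Om // mulgV mulVg T1.
Qed.

Definition thetas e l : A := \prod_(s <- l) theta e s.

Lemma thetas_true l : all S l -> uniq (walls 1%g l) -> thetas true l = tau (g l).
Proof.
rewrite /thetas; elim: l => [|s l IH] Sl ul.
  by rewrite big_nil tau_Om ?pi1 ?T1 //; apply: Om1 proP_ext.
have [_ ul' e] := lenW_cat proP_ext (l1 := [:: s]) Sl ul.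
move: Sl => /= /andP[Ss Sl]; rewrite big_cons IH // theta_true // -tauM //.
by rewrite /= mulg1 in e; rewrite pi_n // pi_word.
Qed.

Lemma thetas_false l : all S l -> uniq (walls 1%g l) ->
  thetas false l * tau (g l)^-1%g = 1 /\ tau (g l)^-1%g * thetas false l = 1.
Proof.
rewrite /thetas; elim: l => [|s l IH] Sl ul.
  by rewrite big_nil mulr1 mul1r /= invg1 tau_Om ?pi1 ?T1 //; apply: Om1 proP_ext.
have e := lenW_catV proP_ext (l1 := [:: s]) Sl ul.
have [_ ul' _] := lenW_cat proP_ext (l1 := [:: s]) Sl ul.
move: Sl => /= /andP[Ss Sl]; rewrite big_cons invgM tauM; last first.
  by rewrite /= mulg1 in e; rewrite !piV pi_n // pi_word.
have [e1 e2] := IH Sl ul'; have [e3 e4] := theta_falseK Ss.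
split.
  by rewrite -mulrA [X in _ * X]mulrA e1 mul1r.
by rewrite -mulrA [X in _ * X]mulrA e4 mul1r.
Qed.

(* [thetas false q1] and [thetas false p2] are inverses of elements [tau]; moving
   them across turns both sides into [tau] of one group element, on which lengths add. *)
Lemma thetas_exchange p1 p2 q1 q2 : all S (p1 ++ p2) -> all S (q1 ++ q2) ->
  uniq (walls 1%g (p1 ++ p2)) -> uniq (walls 1%g (q1 ++ q2)) ->
  g (p1 ++ p2) = g (q1 ++ q2) -> size p1 = size q2 -> size p2 = size q1 ->
  (forall H, H \in walls 1%g p1 -> H \in walls 1%g q1 -> False) ->
  thetas true p1 * thetas false p2 = thetas false q1 * thetas true q2.
Proof.
move=> Sp Sq up uq; rewrite !g_cat => eg sz1 sz2 dis.
have [up1 up2 _] := lenW_cat proP_ext Sp up; have [uq1 uq2 _] := lenW_cat proP_ext Sq uq.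
move: Sp Sq; rewrite !all_cat => /andP[Sp1 Sp2] /andP[Sq1 Sq2].
have [_ e2] := thetas_false Sp2 up2; have [e3 _] := thetas_false Sq1 uq1.
have e : ((g q1)^-1 * g p1 = g q2 * (g p2)^-1)%g.
  by apply: (mulgI (g q1)); rewrite mulVKg mulgA -eg mulgK.
have main : tau (g q1)^-1%g * tau (g p1) = tau (g q2) * tau (g p2)^-1%g.
  have mq l : all S l -> uniq (walls 1%g l) -> seps (wprod l) =i walls 1%g l.
    move=> Sl ul; have := seps_perm proP_ext Sl (Om1 proP_ext) ul; rewrite mulg1.
    exact: perm_mem.
  have e5 : len (pi (g q1)^-1%g * pi (g p1))%g = (len (pi (g q1)^-1%g) + len (pi (g p1)))%N.
    rewrite piV !pi_word //; apply: (lenWV_add proP_ext) => H; rewrite !mq // => H1 H2.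
    exact: dis H2 H1.
  (* On the right the lengths add by counting: the length of the common element is
     [size q1 + size p1], which is [size q2 + size p2]. *)
  rewrite -tauM // e tauM // -piM -e piM e5 !piV !pi_word // !(lenWV proP_ext).
  by rewrite !(lenW_wprod proP_ext) // sz1 sz2 addnC.
rewrite thetas_true // thetas_true // -[tau (g p1)]mul1r -e3.
by rewrite -!mulrA [X in _ * X]mulrA main -mulrA e2 mulr1.
Qed.

(** * Products along arbitrary galleries *)

Implicit Types f : W -> W -> bool.

Fixpoint gal f x l : A := if l is s :: l' then theta (f x s) s * gal f (x * s)%g l' else 1.

Lemma gal_cat f x l1 l2 : gal f x (l1 ++ l2) = gal f x l1 * gal f (x * wprod l1)%g l2.
Proof. by elim: l1 x => [|s l IH] x /=; rewrite ?mulg1 ?mul1r // IH !mulrA mulgA. Qed.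

Lemma gal_const f e x l :
  (forall i, (i < size l)%N -> f (x * wprod (take i l))%g (nth 1%g l i) = e) ->
  gal f x l = thetas e l.
Proof.
rewrite /thetas; elim: l x => [|s l IH] x fe /=; first by rewrite big_nil.
rewrite big_cons IH => [|i il]; last by have := fe i.+1 il; rewrite /= mulgA.
by have := fe 0%N isT; rewrite /= mulg1 => ->.
Qed.

Lemma gal_alt f x s t m k e1 e2 : (k <= m)%N ->
  (forall i, (i < m)%N ->
     f (x * wprod (alt s t i))%g (if odd i then t else s) = if (i < k)%N then e1 else e2) ->
  gal f x (alt s t m) = thetas e1 (take k (alt s t m)) * thetas e2 (drop k (alt s t m)).
Proof.
move=> km fe; rewrite -{1}(cat_take_drop k (alt s t m)) gal_cat.
congr (_ * _); apply: gal_const => i.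
  rewrite size_take_min size_alt (minn_idPl km) => ik.
  have im := leq_trans ik km.
  by rewrite nth_take // take_takel ?(ltnW ik) // take_alt ?(ltnW im) // nth_alt // fe // ik.
rewrite size_drop size_alt => ik; have im : (k + i < m)%N by rewrite -ltn_subRL.
rewrite nth_drop -mulgA -wprod_cat -takeD take_alt ?(ltnW im) // nth_alt // fe //.
by rewrite ltnNge leq_addr.
Qed.

(** Each half of the [2m]-gon splits into a block of one sign followed by a block of the other,
    which is the situation of [thetas_exchange]. *)
Lemma gal_braid_pm f x s t m k : S s -> S t -> order_is (s * t)%g m -> (k <= m)%N ->
  (forall i, (i < m)%N ->
    f (x * wprod (alt s t i))%g (if odd i then t else s) = (i < k)%N /\
    f (x * wprod (alt t s i))%g (if odd i then s else t) = (m - k <= i)%N) ->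
  gal f x (alt s t m) = gal f x (alt t s m).
Proof.
move=> Ss St ord km fe; have [_ [stm _]] := ord.
have ss := gen_sq (ext_cox proP_ext) Ss; have tt := gen_sq (ext_cox proP_ext) St.
rewrite (gal_alt (k := k) (e1 := true) (e2 := false)) //; last first.
  by move=> i /fe[-> _]; case: ltnP.
rewrite (gal_alt (k := m - k) (e1 := false) (e2 := true)) ?leq_subr //; last first.
  by move=> i /fe[_ ->]; case: ltnP.
have u := uniq_walls_alt 1%g ss tt ord.
have rw := rev_walls_alt 1%g ss tt stm.
apply: thetas_exchange; rewrite ?cat_take_drop ?all_alt ?rw ?rev_uniq //.
- exact: n_braid.
- by rewrite size_take_min size_drop !size_alt (minn_idPl km) subKn.
- by rewrite size_take_min size_drop !size_alt (minn_idPl (leq_subr _ _)).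
(* The first [m-k] walls of the second word are the last [m-k] of the first, hence distinct from its
   first [k]. *)
move=> H; rewrite !walls_take rw take_rev mem_rev size_walls size_alt subKn // => H1 H2.
move: u; rewrite -(cat_take_drop k (walls _ _)) cat_uniq => /and3P[_ /hasPn/(_ _ H2)/negP].
by [].
Qed.

Lemma gal_braid f x s t m : gallery_orientation S Om f -> S s -> S t -> order_is (s * t)%g m ->
  gal f x (alt s t m) = gal f x (alt t s m).
Proof.
case=> _ _ fb Ss St ord; have [k [km h]] := fb x s t m Ss St ord.
case: h => h; first exact: gal_braid_pm km h.
(* Exchanging [s] and [t] turns the second alternative of (OR2) into the first. *)
apply/esym/(gal_braid_pm _ _ _ km) => // [|i /h[]//].
have -> : (t * s)%g = cj t (s * t)%g by rewrite /cj mulgA mulgK.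
exact: order_cj.
Qed.

(** The lift [n (cj (pi u) s)] need not equal the conjugate of [n s] by [u], so [u] changes by an
    element of the kernel when it passes the factor. For the term in [b], compatibility of the
    parameters and [Tb_coinv] absorb this change. *)
Lemma T_theta e u s : Om (pi u) -> S s ->
  T u * theta e s = theta e (cj (pi u) s) * T ((n (cj (pi u) s))^-1 * u * n s)%g.
Proof.
move=> Ou Ss; set s' := cj (pi u) s; have Ss' : S s' := gen_cj proP_ext Ou Ss.
set u' := (_ * n s)%g.
have es : sqa s = sqa s' by rewrite -(sqaH_cj 1 Ss') cj1 sqaH_cj.
have eu' : pi u' = pi u by rewrite !piM piV !pi_n // -mulgA -[(pi u * s)%g]mul_cj mulKg.
have eT : T u * T (n s) = T (n s') * T u'.
  by rewrite -T_Oml // -T_Omr ?eu' // /u' mulgA mulVKg.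
rewrite /theta es -scalerAr -scalerAl; congr (_ *: _); case: e => //.
rewrite mulrBl mulrBr eT; congr (_ - _).
(* [k] measures the discrepancy between the two lifts of [s']. *)
pose k := (n s' * u * (n s)^-1 * u^-1)%g.
have kk : pi k = 1%g.
  by rewrite !piM !piV !pi_n // mul_cj mulgK mulgV.
have := Tb_conj (w := u) Ss' Ss; rewrite mul_cj -/k => /(_ erefl) e.
have kV : pi k^-1%g = 1%g by rewrite piV kk invg1.
rewrite T_Tb ?ker_sum_b //.
have -> : Tb T (conjb u (b s)) = T k^-1%g * Tb T (b s').
  by rewrite -e mulrA -T_Oml ?ker_Om // mulVg T1 mul1r.
have kj : pi ((n s')^-1 * k^-1 * n s')%g = 1%g.
  by rewrite -{2}[n s']invgK ker_cj.
have -> : u' = ((n s')^-1 * k^-1 * n s' * u)%g.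
  by rewrite /u' /k !invgM !invgK !mulgA !mulgVK.
rewrite (T_Oml _ (ker_Om kj)) mulrA -comm_ker_sum ?ker_sum_b // -(Tb_coinv Ss' kj).
by rewrite !mulgA mulgV mul1g mulgK.
Qed.

Lemma T_gal f y u l : gallery_orientation S Om f -> Om (pi u) -> all S l ->
  T u * gal f (y * pi u)%g l =
  gal f y (map (cj (pi u)) l) * T ((g (map (cj (pi u)) l))^-1 * u * g l)%g.
Proof.
move=> fo; elim: l y u => [|s l IH] y u Ou /=; first by rewrite invg1 mul1g !mulg1 mulr1 mul1r.
case/andP=> Ss Sl; have [_ fO _] := fo; rewrite fO // mulrA T_theta //.
set s' := cj (pi u) s; have Ss' : S s' := gen_cj proP_ext Ou Ss.
set u' := (_ * n s)%g.
have eu' : pi u' = pi u by rewrite !piM piV !pi_n // -mulgA -[(pi u * s)%g]mul_cj mulKg.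
have -> : (y * pi u * s = y * s' * pi u')%g by rewrite eu' -[LHS]mulgA -[RHS]mulgA mul_cj.
rewrite -mulrA IH ?eu' // mulrA; congr (_ * _ * T _).
by rewrite /u' invgM !mulgA.
Qed.

Lemma ker_gal f y k l : gallery_orientation S Om f -> pi k = 1%g -> all S l ->
  T k * gal f y l = gal f y l * T ((g l)^-1 * k * g l)%g.
Proof.
move=> fo kk Sl; have := T_gal y fo (ker_Om kk) Sl; rewrite kk mulg1.
by have -> : map (cj 1%g) l = l by rewrite -[RHS]map_id; apply: eq_map => z; rewrite cj1.
Qed.

(** Lifts of two words for one element differ by an element of the kernel, which is the correction
    factor. Deleting [ss] produces [T (n s * n s)], which [ker_gal] carries to the end of the
    gallery; a braid move needs no correction. *)
Lemma gal_word_inv f x l1 l2 : gallery_orientation S Om f -> all S l1 -> all S l2 ->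
  wprod l1 = wprod l2 -> gal f x l1 * T ((g l1)^-1 * g l2)%g = gal f x l2.
Proof.
move=> fo Sl1 Sl2 e12.
(* The first component keeps the correction factors in the kernel, so that they multiply. *)
pose E l1 l2 := pi (g l1) = pi (g l2) /\ gal f x l1 * T ((g l1)^-1 * g l2)%g = gal f x l2.
suff: E l1 l2 by case.
apply: (word_rel_ind (ext_cox proP_ext)) e12 => // {Sl1 Sl2 l1 l2}.
- by move=> l; split=> //; rewrite mulVg T1 mulr1.
- rewrite /E => l1 l2 [e <-]; split=> //; rewrite -mulrA -T_Oml; last first.
    by rewrite piM piV e mulVg; apply: Om1 proP_ext.
  by rewrite -mulgA mulVKg mulVg T1 mulr1.
- rewrite /E => l1 l2 l3 [e <-] [e' <-]; split; first by rewrite e.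
  rewrite -mulrA -T_Oml; last by rewrite piM piV e mulVg; apply: Om1 proP_ext.
  by rewrite -mulgA mulVKg.
- move=> u v s Su Sv Ss; have kk := ker_n2 Ss.
  have kk' : pi ((g v)^-1 * (n s * n s) * g v)%g = 1%g.
    by rewrite -{2}[g v]invgK ker_cj.
  split; first by rewrite !g_cat /= mulg1 !piM -[(pi (n s) * _)%g]piM kk mul1g.
  rewrite !gal_cat /= mulr1 mulg1; have [fs _ _] := fo; rewrite fs // theta_flip //.
  rewrite (gen_sq (ext_cox proP_ext) Ss) mulg1.
  rewrite -mulrA ker_gal // -!mulrA -T_Oml ?ker_Om //.
  rewrite !g_cat /= !invgM !mulgA.
  by rewrite !mulgK mulgVK mulVg T1 mulr1.
- move=> u v s t m Su Sv Ss St ord; have e := n_braid Ss St ord.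
  have [_ [stm _]] := ord.
  have e' := wprod_alt (gen_sq (ext_cox proP_ext) Ss) (gen_sq (ext_cox proP_ext) St) stm.
  split; first by rewrite !g_cat e.
  by rewrite !gal_cat !g_cat e e' (gal_braid _ fo Ss St ord) mulVg T1 mulr1.
Qed.

(** * The Bernstein cocycle *)

(* The normalized Bernstein element of [w] for the orientation [f] translated by
   [x]; keeping [x] as an argument makes it a cocycle, see [bernM]. *)
Definition bern f x w : A :=
  gal f x (bdec S Wa Om pi n w).1 * T (bdec S Wa Om pi n w).2.

Lemma bdecP w : let p := bdec S Wa Om pi n w in
  [/\ all S p.1, uniq (walls 1%g p.1), Om (pi p.2) & w = (g p.1 * p.2)%g].
Proof.
suff: exists p : seq W * W1, all S p.1 /\ size p.1 = len1 S Wa Om pi w /\ Om (pi p.2) /\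
    w = (wprod (map n p.1) * p.2)%g.
  case/(epsilon_spec (inhabits ([::], 1%g))); rewrite -/(bdec S Wa Om pi n w).
  move: (bdec _ _ _ _ _ _) => [l u] /= Sl [sz [Ou e]]; split=> //.
  by apply: (lenW_uniq proP_ext Sl Ou); rewrite sz /len1 e piM pi_word.
have [Sl ul el] := wordP proP_ext (pi w); have [_ Ou ew] := decompP proP_ext (pi w).
exists (word S Wa Om (pi w), (g (word S Wa Om (pi w)))^-1 * w)%g => /=; split=> //.
split=> //.
split; last by rewrite mulVKg.
rewrite piM piV pi_word // el.
suff -> : ((wpart Wa Om (pi w))^-1 * pi w = opart Wa Om (pi w))%g by [].
by rewrite {2}ew mulKg.
Qed.

(** By [gal_word_inv] the word [l] need not be reduced, nor be the one chosen by [bdec]. *)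
Lemma bernE f x l u : gallery_orientation S Om f -> all S l -> Om (pi u) ->
  bern f x (g l * u)%g = gal f x l * T u.
Proof.
move=> fo Sl Ou; rewrite /bern; have [] := bdecP (g l * u)%g.
move: (bdec _ _ _ _ _ _) => [l' u'] /= Sl' _ Ou' e.
have := congr1 pi e; rewrite !piM !pi_word // => e'.
have [ew eu] := decomp_inj proP_ext (Wa_word proP_ext Sl) Ou (Wa_word proP_ext Sl') Ou' e'.
rewrite -(gal_word_inv x fo Sl Sl' ew) -mulrA -T_Omr //.
by rewrite -mulgA -e mulKg.
Qed.

Lemma bern_expr w : exists l u, [/\ all S l, Om (pi u) & w = (g l * u)%g].
Proof. by have [? _ ? ?] := bdecP w; do 2!eexists; split; eassumption. Qed.

(** Concatenate the galleries; [T_gal] moves the length-zero part of [w] past the gallery of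
    [w']. *)
Lemma bernM f x w w' : gallery_orientation S Om f ->
  bern f x (w * w')%g = bern f x w * bern f (x * pi w)%g w'.
Proof.
move=> fo; have [l [u [Sl Ou ->]]] := bern_expr w; have [l' [u' [Sl' Ou' ->]]] := bern_expr w'.
have Sl'' := gen_cj_word proP_ext Ou Sl'.
have -> : (g l * u * (g l' * u') = g (l ++ map (cj (pi u)) l') *
    ((g (map (cj (pi u)) l'))^-1 * u * g l' * u'))%g.
  by rewrite g_cat !mulgA mulgK.
have O2 : Om (pi ((g (map (cj (pi u)) l'))^-1 * u * g l')%g).
  by rewrite !piM piV !pi_word // wprod_cj -mulgA -[(pi u * _)%g]mul_cj mulKg.
rewrite !bernE ?all_cat ?Sl //; last by rewrite piM; apply: OmM proP_ext _ _ O2 Ou'.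
rewrite gal_cat T_Oml // piM pi_word // mulgA -!mulrA; congr (_ * _).
by rewrite !mulrA T_gal.
Qed.

Lemma bern_ker f x k : gallery_orientation S Om f -> pi k = 1%g -> bern f x k = T k.
Proof.
by move=> fo kk; have := bernE x (l := [::]) fo isT (ker_Om kk); rewrite /= mul1g mul1r.
Qed.

Lemma gal_iota f x l : all S l ->
  gal f x l = (\prod_(s <- l) sqa s)^-1 *: \prod_(i <- iota 0 (size l))
    (if f (x * wprod (take i l))%g (nth 1%g l i) then T (n (nth 1%g l i))
     else T (n (nth 1%g l i)) - Tb T (b (nth 1%g l i))).
Proof.
elim: l x => [|s l IH] x /=; first by rewrite !big_nil invr1 scale1r.
case/andP=> Ss Sl; rewrite !big_cons (iotaDl 1 0) big_map /= mulg1 IH //.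
rewrite invrM ?sqa_unit //; last first.
  rewrite big_seq; apply: (big_ind (fun z => z \is a GRing.unit)) => [|y z uy uz|t].
  - exact: unitr1.
  - by rewrite unitrM uy uz.
  - by move/(allP Sl)/sqa_unit.
rewrite /theta -scalerAl -scalerAr scalerA [X in X *: _]mulrC; congr (_ *: (_ * _)).
by apply: eq_bigr => i _; rewrite /= mulgA.
Qed.

Lemma theta_tildeE o0 w :
  theta_tilde S Wa Om pi n b T sqa o0 w = bern (oW Wa Om o0) 1%g w.
Proof.
rewrite /theta_tilde /theta_hat /bern; have [] := bdecP w.
move: (bdec _ _ _ _ _ _) => [l u] /= Sl ul Ou ew.
have -> : Lbar S Wa Om pi sqa w = \prod_(s <- l) sqa s.
  rewrite -(Lw_word Sl ul) /Lbar ew piM pi_word //.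
  have := seps_perm proP_ext Sl (Om1 proP_ext) ul; rewrite mulg1 perm_sym => p.
  by apply: perm_big; apply: perm_trans (seps_perm proP_ext Sl Ou ul) p.
rewrite gal_iota // scalerAl; congr (_ *: _ * _); apply: eq_bigr => i _.
rewrite mul1g /oW1 /oW pi_word //.
by apply/allP => s /mem_take; apply: allP Sl s.
Qed.

(** * Conjugation on [R[T]] and the elements [Xi] *)

Lemma bern_kerl f x k w : gallery_orientation S Om f -> pi k = 1%g ->
  T k * bern f x w = bern f x (k * w)%g.
Proof. by move=> fo kk; rewrite bernM // (bern_ker x fo kk) kk mulg1. Qed.

Lemma bern_comm f x w k : gallery_orientation S Om f -> pi k = 1%g ->
  bern f x w * T k = T (w * k * w^-1)%g * bern f x w.
Proof.
move=> fo kk; rewrite bern_kerl ?ker_cj // mulgVK bernM //.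
by rewrite (bern_ker _ fo kk).
Qed.

Lemma bern_Tb f x w c : gallery_orientation S Om f -> ker_sum c ->
  bern f x w * Tb T c = Tb T (conjb w c) * bern f x w.
Proof. by move=> fo kc; apply: Tb_intertwine => // k; apply: bern_comm. Qed.

Lemma bernK f x w : gallery_orientation S Om f ->
  bern f x w * bern f (x * pi w)%g w^-1%g = 1.
Proof. by move=> fo; rewrite -bernM // mulgV bern_ker ?pi1 // T1. Qed.

(* Conjugation by [w] on [R[T]] is conjugation by the invertible element [bern f 1 w]. *)
Lemma Tb_transport f w j j' c c' : gallery_orientation S Om f ->
  pi j = 1%g -> pi j' = 1%g -> ker_sum c -> ker_sum c' ->
  T j * Tb T c = T j' * Tb T c' ->
  T (w * j * w^-1)%g * Tb T (conjb w c) = T (w * j' * w^-1)%g * Tb T (conjb w c').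
Proof.
move=> fo kj kj' kc kc' e.
have h i d : pi i = 1%g -> ker_sum d ->
    T (w * i * w^-1)%g * Tb T (conjb w d) =
    bern f 1%g w * (T i * Tb T d) * bern f (1 * pi w)%g w^-1%g.
  move=> ki kd; rewrite mulrA bern_comm // -(mulrA _ _ (Tb T d)) bern_Tb //.
  by rewrite -2!mulrA bernK // mulr1.
by rewrite !h // e.
Qed.

(** Independence of the choice made in [Xi]: passing from one pair to another changes the
    coefficient in [R[T]] and the lift of the hyperplane by kernel elements that cancel. *)
Lemma XiE o0 w s : is_orientation S Wa o0 -> S s ->
  Xi S Wa Om pi n b T sqa o0 (cj (pi w) s) =
  (sqa s)^-1 *: (Tb T (conjb w (b s)) * bern (oW Wa Om o0) 1%g (w * (n s)^-1 * w^-1)%g).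
Proof.
move=> oo Ss; have fo := oW_gallery proP_ext oo.
have : exists p : W1 * W, S p.2 /\ pi (p.1 * n p.2 * p.1^-1)%g = cj (pi w) s.
  by exists (w, s); rewrite /= !piM piV pi_n.
case/(epsilon_spec (inhabits (1%g, 1%g))); rewrite /Xi; move: (epsilon _ _) => [p r] /= Sr.
rewrite theta_tildeE; move: (oW Wa Om o0) fo => f fo.
rewrite !piM piV pi_n // -/(cj (pi p) r) => er.
have -> : sqa r = sqa s by rewrite -(sqaH_cj (pi p) Sr) er sqaH_cj.
congr (_ *: _).
pose hp := (p * n r * p^-1)%g; pose hw := (w * n s * w^-1)%g.
have epi : pi hp = pi hw by rewrite !piM !piV !pi_n.
have kk : pi (hp * hw^-1)%g = 1%g by rewrite piM piV epi mulgV.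
have kj : pi (hw^-1 * hp)%g = 1%g by rewrite piM piV epi mulVg.
(* Compatibility of the parameters along [p^-1 * w], conjugated by [p]. *)
have e1 : Tb T (conjb p (b r)) = T (hp * hw^-1)%g * Tb T (conjb w (b s)).
  have ew : (r * pi (p^-1 * w) = pi (p^-1 * w) * s)%g.
    by rewrite piM piV; apply: (mulgI (pi p)); rewrite !mulgA -/(cj (pi p) r) er mulgV mul1g mul_cj.
  pose j := (n r * (p^-1 * w) * (n s)^-1 * (p^-1 * w)^-1)%g.
  have kj' : pi j = 1%g by rewrite piM piM piM !piV !pi_n // ew mulgK mulgV.
  have e : T j * Tb T (conjb (p^-1 * w)%g (b s)) = T 1%g * Tb T (b r).
    by rewrite T1 mul1r; apply: Tb_conj Sr Ss ew.
  have := Tb_transport p fo kj' pi1 (ker_sum_conjb _ (ker_sum_b Ss)) (ker_sum_b Sr) e.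
  rewrite -conjbM mulVKg mulg1 mulgV T1 mul1r => <-.
  by congr (T _ * _); rewrite /j /hp /hw !invgM !invgK !mulgA !mulgK.
(* The order is changed by [Tb_coinv], conjugated by [w], so that the kernel element turns the
   inverse of [hp] into that of [hw]. *)
have e2 : T (hp * hw^-1)%g * Tb T (conjb w (b s)) = T (hw^-1 * hp)%g * Tb T (conjb w (b s)).
  pose j := (w^-1 * (hw^-1 * hp) * w)%g.
  have kj' : pi j = 1%g by rewrite /j -{2}[w]invgK ker_cj.
  have := Tb_transport w fo (ker_cj (n s) kj') kj' (ker_sum_b Ss) (ker_sum_b Ss) (Tb_coinv Ss kj').
  have -> : (w * (n s * j * (n s)^-1) * w^-1 = hp * hw^-1)%g.
    by apply: (mulgI hw^-1%g); rewrite /j /hw !invgM !invgK !mulgA !mulgVK.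
  by rewrite /j [(w * _)%g]mulgA mulVKg mulgK.
rewrite e1 e2 comm_ker_sum ?ker_sum_conjb ?ker_sum_b // -mulrA bern_kerl //.
by congr (_ * bern _ _ _); rewrite /hp /hw !invgM !invgK !mulgA mulgVK !mulgK.
Qed.

Lemma gal_ext f f' x x' l : all S l ->
  (forall y s, S s -> f (x * y)%g s = f' (x' * y)%g s) -> gal f x l = gal f' x' l.
Proof.
elim: l x x' => //= s l IH x x' /andP[Ss Sl] e.
have := e 1%g s Ss; rewrite !mulg1 => ->; congr (_ * _); apply: IH => // y t St.
by rewrite -!mulgA e.
Qed.

Lemma theta_diff e s : theta e s - theta (~~ e) s = sgnR R e *: ((sqa s)^-1 *: Tb T (b s)).
Proof.
rewrite /theta /sgnR; case: e => /=; rewrite -scalerBr.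
  by rewrite opprB addrC subrK scale1r.
by rewrite addrAC subrr add0r scalerN scaleN1r.
Qed.

(** * The difference formula for adjacent orientations *)

Section Main.
Variables o0 o0' : W -> W -> bool.
Hypotheses (ho : is_orientation S Wa o0) (ho' : is_orientation S Wa o0').
Hypothesis hadj : adjacent S Wa Om pi o0 o0'.

Local Notation f := (oW Wa Om o0).
Local Notation f' := (oW Wa Om o0').
Local Notation Xi' := (Xi S Wa Om pi n b T sqa o0').
Local Notation oHo := (oH S Wa Om).

(** Adjacency gives the sign of [o0] at [H * x]; apply it to [H * x] in place of [x] and use that
    [H] is an involution. *)
Lemma adjacentE H x s : hyperplane S Wa H -> oHo o0 H != oHo o0' H -> S s ->
  f x s = f' (H * x)%g s.
Proof.
move=> hH' dH Ss; case: hW => _ [_ [surj _]].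
have [h eh] := surj H; have [w ew] := surj (H * x)%g.
have := hadj hH' dH eh w Ss; rewrite /oW1 -/(oW Wa Om o0 _ _) -/(oW Wa Om o0' _ _).
rewrite piM eh ew; suff -> : (H * (H * x) = x)%g by [].
case: hH' => v [t [_ [St ->]]]; rewrite mulgA -/(cj v t).
by rewrite -cj_mulg (gen_sq (ext_cox proP_ext)) // cjg1 mul1g.
Qed.

Lemma Xi_gal l s : all S l -> S s -> cj (wprod l) s \notin walls 1%g l -> uniq (walls 1%g l) ->
  f (wprod l) s != f' (wprod l) s ->
  oHo o0 (cj (wprod l) s) != oHo o0' (cj (wprod l) s) ->
  Xi' (cj (wprod l) s) * gal f 1%g (rcons l s) =
  gal f' 1%g l * ((sqa s)^-1 *: Tb T (b s)).
Proof.
move=> Sl Ss nH ul df dH; have fo := oW_gallery proP_ext ho'.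
set H := cj (wprod l) s in dH *.
have hH' : hyperplane S Wa H by exists (wprod l), s; split; first exact (Wa_word proP_ext Sl).
have Sls : all S (rcons l s) by rewrite all_rcons Ss.
(* Adjacency trades [f] for [f'] at the price of starting the gallery at [H] instead of [1]. *)
rewrite (gal_ext (f' := f') (x' := H) Sls); last first.
  by move=> y t St; rewrite mul1g; apply: adjacentE.
have galE x q : all S q -> gal f' x q = bern f' x (g q).
  move=> Sq; rewrite -[g q]mulg1 (bernE x fo Sq) ?pi1 ?T1 ?mulr1 //.
  exact: Om1 proP_ext.
have eH : H = (1 * pi (g l * (n s)^-1 * (g l)^-1))%g.
  by rewrite mul1g !piM !piV pi_word // pi_n // (gen_inv (ext_cox proP_ext)).
rewrite !galE // {1}/H -{1}(pi_word Sl) XiE // -scalerAl -scalerAr; congr (_ *: _).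
(* With the coefficient moved to the left on both sides, the cocycle rule applies: the lift of [H]
   followed by [g l * n s] multiplies to [g l]. *)
rewrite bern_Tb ?ker_sum_b // -mulrA; congr (_ * _).
rewrite {1}eH -bernM //; congr bern.
by rewrite map_rcons wprod_rcons mulgA !mulgVK.
Qed.

Lemma gal_difference l : all S l -> uniq (walls 1%g l) ->
  gal f 1%g l - gal f' 1%g l =
  (\sum_(H <- walls 1%g l | oHo o0 H != oHo o0' H) sgnR R (oHo o0 H) *: Xi' H) * gal f 1%g l.
Proof.
elim/last_ind: l => [|l s IH]; first by rewrite /= big_nil subrr mul0r.
rewrite all_rcons => /andP[Ss Sl]; rewrite walls_rcons rcons_uniq mul1g => /andP[nH ul].
(* The last wall is not crossed by [l], so [1] and [wprod l] lie on the same side and [oHE] reads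
   off its sign at [wprod l]. *)
have nseps : cj (wprod l) s \notin seps (wprod l).
  have := mem_seps proP_ext (cj (wprod l) s) Sl (Om1 proP_ext); rewrite mulg1 => ->.
  by rewrite count_uniq_mem // (negPf nH).
have e := oHE proP_ext ho Ss nseps; have e' := oHE proP_ext ho' Ss nseps.
have galr h : gal h 1%g (rcons l s) = gal h 1%g l * theta (h (wprod l) s) s.
  by rewrite -cats1 gal_cat /= mulr1 mul1g.
rewrite -[rcons (walls _ _) _]cats1 big_cat big_cons big_nil /=.
case: ifP => dH; last first.
  rewrite addr0 !galr; move/negbFE/eqP: dH; rewrite e e' => ->.
  by rewrite -mulrBl IH // mulrA.
have nf : f (wprod l) s != f' (wprod l) s by rewrite -e -e'.
rewrite addr0 mulrDl -scalerAl Xi_gal // scalerAr e -theta_diff !galr mulrA -IH //.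
have -> : f' (wprod l) s = ~~ f (wprod l) s.
  by move: nf; case: (f _ _); case: (f' _ _).
by rewrite mulrBl mulrBr addrA subrK.
Qed.

End Main.
End Hecke.

Theorem theorem2p10p3
  (W : groupType) (S Wa Om : pred W) (W1 : groupType) (pi : W1 -> W) (n : W -> W1)
  (R : comUnitRingType) (A : algType R) (a : W -> R) (b : W -> seq (R * W1))
  (T : W1 -> A) (sqa : W -> R)
  (hW : proP_coxeter S Wa Om pi n)
  (hH : generic_hecke S Wa Om pi n a b T)
  (hsq : sqrt_params S a sqa)
  (w : W1) (o0 o0' : W -> W -> bool)
  (ho : is_orientation S Wa o0) (ho' : is_orientation S Wa o0')
  (hadj : adjacent S Wa Om pi o0 o0') :
  theta_tilde S Wa Om pi n b T sqa o0 w - theta_tilde S Wa Om pi n b T sqa o0' w =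
  (\sum_(H <- seps S Wa Om (pi w) | oH S Wa Om o0 H != oH S Wa Om o0' H)
     sgnR R (oH S Wa Om o0 H) *: Xi S Wa Om pi n b T sqa o0' H)
  * theta_tilde S Wa Om pi n b T sqa o0 w.
Proof.
rewrite !(theta_tildeE b T hW hsq) /bern; have [] := bdecP hW w.
move: (bdec _ _ _ _ _ _) => [l u] /= Sl ul Ou ew.
(* The words chosen by [seps] and by [bdec] may differ, but both are reduced and cross the same
   walls up to order. *)
rewrite {1}ew (piM hW) (pi_word hW) // (perm_big _ (seps_perm (proP_ext hW) Sl Ou ul)) /=.
by rewrite -mulrBl (gal_difference hW hH hsq) // mulrA.
Qed.
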